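(* There is a deterministic algorithm which, given independence-oracle access to two matroids $\mathcal{M}_1=(V,\mathcal{I}_1)$ and $\mathcal{M}_2=(V,\mathcal{I}_2)$ on a common ground set $V$ with $|V|=n$, uses $O(nr^{5/6}\log r + n^{6/5}r^{3/5}\log^{4/5} r)$ independence queries and solves the matroid intersection problem, i.e. outputs a maximum-cardinality set $S\in\mathcal{I}_1\cap\mathcal{I}_2$, where $r$ denotes the size of such a set. In particular, when $r=\Theta(n)$, the number of queries is $\tilde O(n^{11/6})$.
   Context: A matroid $\mathcal{M}=(V,\mathcal{I})$ consists of a finite ground set $V$ and a nonempty family $\mathcal{I}\subseteq 2^V$ of independent sets that is downward closed and satisfies the exchange property (if $A,B\in\mathcal{I}$ with $|A|<|B|$, then there is $v\in B\setminus A$ with $A\cup\{v\}\in\mathcal{I}$). In the matroid intersection problem, we are given two matroids on the same ground set $V$ of size $n$ and must find a largest common independent set $S\in\mathcal{I}_1\cap\mathcal{I}_2$; $r$ denotes its size. Access to the matroids is only through independence oracles: given $X\subseteq V$ and $i\in\{1,2\}$, the oracle answers whether $X\in\mathcal{I}_i$. The cost of an algorithm is the number of such independence queries it makes. $\tilde O$ hides polylogarithmic factors in $n$. *)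

(* Defs.v *)
From HB Require Import structures.
From mathcomp Require Import all_boot all_order all_algebra.
From mathcomp Require Import reals exp.

Set Implicit Arguments.
Unset Strict Implicit.
Unset Printing Implicit Defensive.

Record matroid (V : finType) := Matroid {
  indep : {set {set V}};
  indep_nonempty : indep != set0;
  indep_down : forall A B : {set V},
    A \subset B -> B \in indep -> A \in indep;
  indep_exchange : forall A B : {set V},
    A \in indep -> B \in indep -> #|A| < #|B| ->
    exists2 v, v \in B :\: A & v |: A \in indep
}.

Definition common_indep (V : finType) (M1 M2 : matroid V) : {set {set V}} :=
  indep M1 :&: indep M2.

Definition intersection_rank (V : finType) (M1 M2 : matroid V) : nat :=
  \max_(S in common_indep M1 M2) #|S|.

Definition max_common_indep (V : finType) (M1 M2 : matroid V) (S : {set V}) :=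
  S \in common_indep M1 M2 /\
  forall T : {set V}, T \in common_indep M1 M2 -> #|T| <= #|S|.

Variant oracle := Oracle1 | Oracle2.

(* A deterministic query algorithm on the ground set V is a decision tree: it
   sees the matroids only through the answers to its queries, and a query may
   depend on all earlier answers. Only queries are charged, so internal
   computation is not represented. *)
Inductive query_alg (V : finType) :=
  | Output of {set V}
  | Query of oracle & {set V} & (bool -> query_alg V).

Definition answer (V : finType) (M1 M2 : matroid V) (i : oracle)
    (X : {set V}) : bool :=
  match i with Oracle1 => X \in indep M1 | Oracle2 => X \in indep M2 end.

Fixpoint run (V : finType) (M1 M2 : matroid V) (a : query_alg V) : {set V} :=
  match a with
  | Output A => A
  | Query i X k => run M1 M2 (k (answer M1 M2 i X))
  end.

Fixpoint num_queries (V : finType) (M1 M2 : matroid V) (a : query_alg V) :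
    nat :=
  match a with
  | Output _ => 0
  | Query i X k => (num_queries M1 M2 (k (answer M1 M2 i X))).+1
  end.

(* Main.v *)
(* Labels p on the ground set play the role of distances in the exchange graph
   of a common independent set S: elements outside S with label > j lie in the
   M1-span of the part of S with label >= j, those with label <= j in the
   M2-span of the part of S with label <= j (for j < l).  Cutting at the
   sparsest level then gives r - |S| <= |S| / l.  Let q be about r^(1/6).

   (1) An auction in which elements outside S bid by raising their labels,
   pushing elements of S out, has labels at most q; a round costs O(n) queries
   and the sum of the labels of S bounds the number of rounds.  It reaches
   r - |S| = O(q^5).
   (2) Augmenting along shortest paths preserves the label inequalities, so
   labels only increase and maintaining the exact layers up to distance q^5
   costs O(n log r) per augmentation or new level.  It reaches r - |S| = O(q).
   (3) Each remaining augmentation is a reachability problem, solved with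
   O(n q^4 log r) queries.  An element v outside S is light when all its
   M2-neighbours not yet reached are known, and heavy when q^2 of them are; a
   backward search from the heavy elements and the sinks runs through light
   elements only, so that one pass of O(n log r) queries either reaches q^2 new
   elements of S, or augments, or proves optimality.  Letting each u in S occur
   in at most n / q^2 lists bounds the cost of refilling the lists.

   The total is O(n q^5 log r), the first of the two terms. *)
Require Import Defs.
From HB Require Import structures.
From mathcomp Require Import all_boot all_order all_algebra.
From mathcomp Require Import reals exp.
From mathcomp Require Import zify ring lra boolp.

Set Implicit Arguments.
Unset Strict Implicit.
Unset Printing Implicit Defensive.

(** As r is not known in advance, [q] and the binary search depth [L] are computed from m = 2|S0|,
    where S0 is a maximal common independent set; then r <= m <= 2r.

    An algorithm is fixed before the instance is seen, whereas the invariants are facts about the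
    instance. A strategy is therefore a program together with a precondition on instances. The
    program has to branch on and terminate for every sequence of answers, even an inconsistent one,
    so it retests on known data, without queries, what the invariants guarantee; the impossible
    branches return a default value.

    Augmentation along a shortest path is usually justified by a uniquely perfect matching. Here the
    path is applied one exchange at a time, starting from the sink: after each exchange the
    predecessor of the removed element is the new sink, and inclusions between spans of label
    classes carry both independence and the label inequalities through the recursion. Working with
    spans also lets the same duality argument serve all three stages. *)

(** * Matroid closure *)

(* [lia] preprocesses every boolean hypothesis, which is prohibitively slow with
   set memberships in the context. *)
Ltac nlia :=
  repeat match goal with
  | H : ?T |- _ =>
    lazymatch T with
    | is_true (leq _ _) => fail
    | @eq nat _ _ => fail
    | is_true (@eq_op Datatypes_nat__canonical__eqtype_Equality _ _) => fail
    | nat => fail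
    | _ => clear H
    end
  end; lia.

Ltac generalize_products :=
  repeat match goal with H : is_true (leq _ _) |- _ => revert H
                    | H : @eq nat _ _ |- _ => revert H end;
  repeat match goal with |- context [muln ?a ?b] => generalize (muln a b) end;
  clear; intros.

Ltac plia := do 3 generalize_products; lia.

Section Rank.
Variables (V : finType) (M : matroid V).
Implicit Types (A B C S T X Y : {set V}) (u v x y : V).

Lemma indep_sub A B : A \subset B -> B \in indep M -> A \in indep M.
Proof. exact: indep_down. Qed.

Lemma indep_set0 : set0 \in indep M.
Proof.
have /set0Pn[A Ai] := indep_nonempty M.
exact: indep_sub (sub0set A) Ai.
Qed.

Definition rk A : nat := \max_(B in indep M | B \subset A) #|B|.

Lemma leq_card_rk A B : B \in indep M -> B \subset A -> #|B| <= rk A.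
Proof.
by move=> Bi BA; apply: (leq_bigmax_cond (F := fun B : {set V} => #|B|)); rewrite Bi.
Qed.

Lemma rk_basis A : exists B, [/\ B \in indep M, B \subset A & #|B| = rk A].
Proof.
have P0 : (set0 \in indep M) && (set0 \subset A) by rewrite indep_set0 sub0set.
have [|B /andP[Bi BA] e] := @eq_bigmax_cond _ (fun B => (B \in indep M) && (B \subset A)) (fun B => #|B|).
  by apply/card_gt0P; exists set0.
by exists B; rewrite Bi BA /rk e.
Qed.

Lemma rk_mono A B : A \subset B -> rk A <= rk B.
Proof.
move=> AB; have [C [Ci CA <-]] := rk_basis A.
exact: leq_card_rk Ci (subset_trans CA AB).
Qed.

Lemma rk_card A : rk A <= #|A|.
Proof. by have [C [Ci CA <-]] := rk_basis A; apply: subset_leq_card. Qed.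

Lemma rk_indep A : A \in indep M -> rk A = #|A|.
Proof. by move=> Ai; apply/eqP; rewrite eqn_leq rk_card leq_card_rk. Qed.

Lemma indep_extend A B : A \in indep M -> A \subset B ->
  exists C, [/\ C \in indep M, A \subset C, C \subset B & #|C| = rk B].
Proof.
move=> Ai AB; have [n le_n] := ubnP (rk B - #|A|).
elim: n A Ai AB le_n => // n IHn A Ai AB le_n.
have [ltAB|leBA] := ltnP #|A| (rk B); last first.
  by exists A; split=> //; apply/eqP; rewrite eqn_leq leq_card_rk.
have [D [Di DB cD]] := rk_basis B.
rewrite -cD in ltAB; have [v /setDP[vD vA] vAi] := indep_exchange Ai Di ltAB.
have vAB : v |: A \subset B by rewrite subUset sub1set AB (subsetP DB).
have [|C [Ci AC CB cC]] := IHn _ vAi vAB; first by rewrite cardsU1 vA; nlia.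
by exists C; split=> //; apply: subset_trans AC; apply: subsetUr.
Qed.

Lemma rkU1 x A : rk (x |: A) <= (rk A).+1.
Proof.
have [B [Bi BA <-]] := rk_basis (x |: A).
have BxA : B :\ x \subset A by rewrite subDset.
have := leq_card_rk (indep_sub (subsetDl B [set x]) Bi) BxA.
by have := cardsD1 x B; case: (x \in B) => /=; nlia.
Qed.

End Rank.

(** Defined through rank so that it also makes sense for dependent sets; locked so that membership
    in a span is not rewritten into a rank equation. *)
HB.lock Definition span (V : finType) (M : matroid V) (A : {set V}) :=
  [set x | rk M (x |: A) == rk M A].

Section Span.
Variables (V : finType) (M : matroid V).
Implicit Types (A B C S T X Y : {set V}) (u v x y : V).
Local Notation rk := (rk M).
Local Notation span := (span M).

Lemma span_rk x A : (x \in span A) = (rk (x |: A) == rk A).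
Proof. by rewrite span.unlock inE. Qed.

Lemma notin_span x A : (x \notin span A) = (rk (x |: A) == (rk A).+1).
Proof. by rewrite span_rk; have := rkU1 M x A; have := rk_mono M (subsetUr [set x] A); nlia. Qed.

Lemma sub_span A : A \subset span A.
Proof. by apply/subsetP=> x xA; rewrite span_rk (setUidPr _) // sub1set. Qed.

Lemma mem_span_indep x A : A \in indep M ->
  (x \in span A) = (x \in A) || (x |: A \notin indep M).
Proof.
move=> Ai; have [xA|xA] /= := boolP (x \in A); first exact: (subsetP (sub_span A)).
apply/idP/idP => [|nxA].
  by rewrite span_rk (rk_indep Ai); apply: contraTN => xAi; rewrite rk_indep // cardsU1 xA; nlia.
apply: contraR nxA; rewrite notin_span => /eqP e.
have [B [Bi BxA cB]] := rk_basis M (x |: A).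
suff -> : x |: A = B by [].
by apply/eqP; rewrite eq_sym eqEcard BxA cB e (rk_indep Ai) cardsU1 xA ltnSn.
Qed.

Lemma indep_setU1 x A : A \in indep M -> x \notin span A -> x |: A \in indep M.
Proof. by move=> Ai; rewrite mem_span_indep // negb_or negbK => /andP[]. Qed.

Lemma rk_setU_span A B : A \subset span B -> rk (A :|: B) = rk B.
Proof.
move=> AB; have [C [Ci CB cC]] := rk_basis M B.
have [D [Di CD DAB cD]] := indep_extend Ci (subset_trans CB (subsetUr A B)).
apply/eqP; rewrite eqn_leq [rk B <= _]rk_mono ?subsetUr // andbT -cC -cD.
rewrite leqNgt; apply/negP => ltCD.
have [y /setDP[yD yC]] : exists y, y \in D :\: C.
  by apply/set0Pn; rewrite -card_gt0 cardsD (setIidPr CD); nlia.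
have yCi : y |: C \in indep M by apply: indep_sub Di; rewrite subUset sub1set yD.
have := cardsU1 y C; rewrite yC /= => cyC.
case/setUP: (subsetP DAB y yD) => [yA|yB]; last first.
  by have := leq_card_rk (A := B) yCi; rewrite subUset sub1set yB CB cyC -cC; nlia.
have := subsetP AB y yA; rewrite span_rk => /eqP e.
by have := leq_card_rk yCi (setUS _ CB); rewrite e cyC cC ltnn.
Qed.

Lemma rk_span A : rk (span A) = rk A.
Proof. by rewrite -[in RHS](rk_setU_span (subxx _)) (setUidPl (sub_span A)). Qed.

Lemma span_basis A B : B \in indep M -> B \subset A -> #|B| = rk A -> A \subset span B.
Proof.
move=> Bi BA cB; apply/subsetP=> x xA; rewrite mem_span_indep //.
have [//|xB /=] := boolP (x \in B); apply/negP => xBi.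
have := leq_card_rk (A := A) xBi; rewrite subUset sub1set xA BA cardsU1 xB cB /=; nlia.
Qed.

(** Monotonicity and idempotence of the closure in one statement. Monotonicity is the inner step, by
    extending a basis of [A] to one of [A :|: B]; [rk_setU_span] then removes [A]. *)
Lemma span_subP A B : A \subset span B -> span A \subset span B.
Proof.
move=> AB; apply/subsetP=> x xA; rewrite span_rk.
have e : rk (span A :|: (A :|: B)) = rk (A :|: B).
  apply: rk_setU_span; apply/subsetP => y.
  rewrite span_rk => /eqP ey; rewrite span_rk.
  have [C [Ci CA cC]] := rk_basis M A.
  have [D [Di CD DAB cD]] := indep_extend Ci (subset_trans CA (subsetUl A B)).
  rewrite eqn_leq [rk (A :|: B) <= _]rk_mono ?subsetUr // andbT.
  rewrite leqNgt; apply/negP => lt.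
  have [E [Ei DE EyAB cE]] := indep_extend Di (subset_trans DAB (subsetUr [set y] _)).
  have [z /setDP[zE zD]] : exists z, z \in E :\: D.
    by apply/set0Pn; rewrite -card_gt0 cardsD (setIidPr DE); nlia.
  have zDi : z |: D \in indep M by apply: indep_sub Ei; rewrite subUset sub1set zE.
  case/setU1P: (subsetP EyAB z zE) => [zy|zAB]; last first.
    by have := leq_card_rk (A := A :|: B) zDi; rewrite subUset sub1set zAB DAB cardsU1 zD -cD /=; nlia.
  subst z; have yCi : y |: C \in indep M by apply: indep_sub zDi; apply: setUS.
  have := leq_card_rk yCi (setUS _ CA); rewrite ey cardsU1 -cC.
  by rewrite (contraNN (subsetP CD y)) //=; nlia.
rewrite eqn_leq [rk B <= _]rk_mono ?subsetUr // andbT -[in leqRHS](rk_setU_span AB) -e.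
by rewrite rk_mono // subUset sub1set in_setU xA /= (subset_trans (subsetUr A B)) ?subsetUr.
Qed.

Lemma span_mono A B : A \subset B -> span A \subset span B.
Proof. by move=> AB; apply: span_subP; apply: subset_trans (sub_span B). Qed.

Lemma mem_span_mono A B x : A \subset B -> x \in span A -> x \in span B.
Proof. by move=> /span_mono/subsetP; apply. Qed.

Lemma mem_span_sub A B x : A \subset span B -> x \in span A -> x \in span B.
Proof. by move=> /span_subP/subsetP; apply. Qed.

Lemma mem_span A x : x \in A -> x \in span A.
Proof. exact: (subsetP (sub_span A)). Qed.

Lemma span_exchange x y A : y \in span (x |: A) -> y \notin span A -> x \in span (y |: A).
Proof.
rewrite notin_span !span_rk => /eqP e1 /eqP e2; rewrite e2 eqn_leq -{2}e2.
rewrite [X in _ && X]rk_mono ?subsetUr // andbT.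
by rewrite setUCA e1 rkU1.
Qed.

Lemma leq_card_span A B : A \in indep M -> A \subset span B -> #|A| <= #|B|.
Proof.
by move=> Ai AB; rewrite -(rk_indep (M := M)) //; apply: leq_trans (rk_mono M AB) _; rewrite rk_span rk_card.
Qed.

Lemma indepP A : reflect (forall x, x \in A -> x \notin span (A :\ x)) (A \in indep M).
Proof.
apply: (iffP idP) => [Ai x xA|H].
  by rewrite mem_span_indep ?(indep_sub (subsetDl _ _)) // setD1K // Ai !inE eqxx.
have [B [Bi BA cB]] := rk_basis M A.
suff /eqP-> : A == B by [].
rewrite eq_sym eqEsubset BA; apply/subsetP=> x xA.
apply: contraR (H x xA) => xB; apply/mem_span_mono: (subsetP (span_basis Bi BA cB) x xA).
by rewrite subsetD1 BA.
Qed.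

Lemma span_swap S u x : x \in span S -> u \in S -> x \notin span (S :\ u) -> u \in span (x |: S :\ u).
Proof. by move=> xS uS; apply: span_exchange; rewrite setD1K. Qed.

(** This is uniqueness of the fundamental circuit. If some [a] in [A :\: B] could not be dropped
    from [A], exchange would put [a] in the span of [x] and [S :\ a]; as [B] spans [x] without [a],
    this contradicts independence of [S]. *)
Lemma span_setI S A B x : S \in indep M -> A \subset S -> B \subset S ->
  x \in span A -> x \in span B -> x \in span (A :&: B).
Proof.
move=> Si AS BS xA xB; have [n le_n] := ubnP #|A :\: B|.
elim: n A AS xA le_n => // n IHn A AS xA le_n.
have [AB0|[a aAB]] := set_0Vmem (A :\: B).
  by rewrite (setIidPl _) // -setD_eq0 AB0.
have /setDP[aA aB] := aAB.
suff xAa : x \in span (A :\ a).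
  have := IHn (A :\ a) (subset_trans (subsetDl _ _) AS) xAa.
  have -> : (A :\ a) :&: B = A :&: B.
    by apply/setP=> y; rewrite !inE; case: eqP => [->|]; rewrite ?(negbTE aB) ?andbF.
  apply; have /proper_card : (A :\ a) :\: B \proper A :\: B; last by nlia.
  apply/properP; split; first by rewrite setSD ?subsetDl.
  by exists a; rewrite // !inE eqxx /= andbF.
apply: contraTT (subsetP AS a aA) => xAa.
have aSa : a \in span (S :\ a).
  have := span_swap xA aA xAa; apply: mem_span_sub.
  rewrite subUset sub1set; apply/andP; split.
    by apply: mem_span_mono xB; rewrite subsetD1 BS.
  by apply: subset_trans (sub_span _); apply: setSD.
by apply: contraTN aSa => aS; have /indepP/(_ a aS) := Si.
Qed.

(* The fundamental circuit of [v] minus [v] when [v] is spanned by [S], and all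
   of [S] otherwise: the neighbours of [v] in the exchange graph. *)
Definition supp S v := [set u in S | v \notin span (S :\ u)].

Lemma supp_sub S v : supp S v \subset S.
Proof. by apply/subsetP=> u; rewrite inE => /andP[]. Qed.

(** The link between queries and the exchange graph: one test of [v] against the span of [S :\: U]
    tells whether [v] has a neighbour in [U]. Elements outside the support are removed one by one
    with [span_setI]. *)
Lemma mem_span_supp S v X : S \in indep M -> v \in span S -> X \subset S ->
  (v \in span X) = (supp S v \subset X).
Proof.
move=> Si vS XS; apply/idP/idP => [vX|].
  apply/subsetP=> u; rewrite inE => /andP[uS]; apply: contraR => uX.
  by apply: mem_span_mono vX; rewrite subsetD1 XS.
move=> sX; apply: (mem_span_mono sX).
suff: forall Y, supp S v \subset Y -> Y \subset S -> v \in span Y -> v \in span (supp S v).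
  by apply; first exact: supp_sub.
move=> Y; have [n] := ubnP #|Y :\: supp S v|.
elim: n Y => // n IHn Y le_n sY YS vY.
have [/eqP|[a aYs]] := set_0Vmem (Y :\: supp S v).
  by rewrite setD_eq0 => Ys; apply: mem_span_mono vY.
have /setDP[aY aN] := aYs.
have vSa : v \in span (S :\ a) by move: aN; rewrite inE (subsetP YS) //= negbK.
have vYa : v \in span (Y :\ a).
  have -> : Y :\ a = Y :&: (S :\ a).
    by apply/setP=> z; rewrite !inE; have [/(subsetP YS)->|] := boolP (z \in Y); rewrite ?andbT ?andbF.
  exact: span_setI Si YS (subsetDl _ _) vY vSa.
apply: (IHn (Y :\ a)) => //; last 2 first.
- by rewrite subsetD1 sY.
- exact: subset_trans (subsetDl _ _) YS.
suff /proper_card : (Y :\ a) :\: supp S v \proper Y :\: supp S v by nlia.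
apply/properP; split; first by rewrite setSD ?subsetDl.
by exists a => //; rewrite !inE eqxx /= andbF.
Qed.

End Span.

(** * Query strategies *)

Section Strategy.
Variable V : finType.

Definition inst := (matroid V * matroid V)%type.

Definition mat (I : inst) (o : oracle) : matroid V :=
  match o with Oracle1 => I.1 | Oracle2 => I.2 end.

Inductive prog (A : Type) :=
  | Ret of A
  | Ask of oracle & {set V} & (bool -> prog A).

Fixpoint eval A (I : inst) (a : prog A) : A * nat :=
  match a with
  | Ret x => (x, 0)
  | Ask o X k => let r := eval I (k (X \in indep (mat I o))) in (r.1, r.2.+1)
  end.

(** The continuation also receives the number of queries made, so that in [strat_bind] the second
    program may be chosen separately for each pair of result and cost. *)
Fixpoint bind A B (a : prog A) (n : nat) (f : A -> nat -> prog B) : prog B :=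
  match a with
  | Ret x => f x n
  | Ask o X k => Ask o X (fun b => bind (k b) n.+1 f)
  end.

Lemma eval_bind A B I (a : prog A) n (f : A -> nat -> prog B) :
  eval I (bind a n f) =
  let r := eval I a in let s := eval I (f r.1 (n + r.2)) in (s.1, r.2 + s.2).
Proof.
elim: a n => [x|o X k IHk] n /=; first by rewrite addn0; case: eval.
by rewrite IHk /= addSnnS.
Qed.

Fixpoint to_alg (a : prog {set V}) : query_alg V :=
  match a with
  | Ret X => Output X
  | Ask o X k => Query o X (fun b => to_alg (k b))
  end.

Lemma run_to_alg M1 M2 a : run M1 M2 (to_alg a) = (eval (M1, M2) a).1.
Proof. by elim: a => [//|[] X k IHk] /=; rewrite IHk. Qed.

Lemma num_queries_to_alg M1 M2 a :
  num_queries M1 M2 (to_alg a) = (eval (M1, M2) a).2.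
Proof. by elim: a => [//|[] X k IHk] /=; rewrite IHk. Qed.

(* [P] is what is known about the instance before the first query; the
   algorithm itself must not depend on the instance. *)
Definition strat A (P : inst -> Prop) (Q : A -> nat -> inst -> Prop) :=
  exists a : prog A, forall I, P I -> Q (eval I a).1 (eval I a).2 I.

Lemma strat_ret A P Q (x : A) : (forall I, P I -> Q x 0 I) -> strat P Q.
Proof. by move=> H; exists (Ret x). Qed.

Lemma strat_conseq A (P P' : inst -> Prop) (Q Q' : A -> nat -> inst -> Prop) :
  strat P Q -> (forall I, P' I -> P I) ->
  (forall x c I, P' I -> Q x c I -> Q' x c I) -> strat P' Q'.
Proof. by move=> [a Ha] HP HQ; exists a => I HI; apply/HQ/Ha/HP. Qed.

Lemma strat_ask A o X (P : inst -> Prop) (Q : A -> nat -> inst -> Prop) :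
  strat (fun I => P I /\ X \in indep (mat I o)) (fun x c => Q x c.+1) ->
  strat (fun I => P I /\ X \notin indep (mat I o)) (fun x c => Q x c.+1) ->
  strat P Q.
Proof.
move=> [a Ha] [b Hb]; exists (Ask o X (fun r => if r then a else b)) => I HI /=.
by case: (boolP (X \in indep (mat I o))) => H; [apply: Ha | apply: Hb].
Qed.

Lemma strat_bind A B P (Q : A -> nat -> inst -> Prop) (R : B -> nat -> inst -> Prop) :
  strat P Q ->
  (forall x c, strat (fun I => P I /\ Q x c I) (fun y d => R y (c + d))) ->
  strat P R.
Proof.
move=> [a Ha] H.
have [f Hf] := choice (fun xc : A * nat => H xc.1 xc.2).
exists (bind a 0 (fun x c => f (x, c))) => I HI.
by rewrite eval_bind /= add0n; apply: (Hf (_, _)); split=> //; apply: Ha.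
Qed.

Lemma strat_span A o X v (P : inst -> Prop) (Q : A -> nat -> inst -> Prop) :
  (forall I, P I -> X \in indep (mat I o)) -> v \notin X ->
  strat (fun I => P I /\ v \in span (mat I o) X) (fun x c => Q x c.+1) ->
  strat (fun I => P I /\ v \notin span (mat I o) X) (fun x c => Q x c.+1) ->
  strat P Q.
Proof.
move=> PX vX H1 H2; apply: (strat_ask (o := o) (X := v |: X)).
  apply: strat_conseq H2 _ _ => // I [HI].
  by rewrite mem_span_indep ?PX // (negbTE vX) negbK.
apply: strat_conseq H1 _ _ => // I [HI].
by rewrite mem_span_indep ?PX // (negbTE vX).
Qed.

(** Closes the branches that no admissible instance reaches: a program must be given there too, and
    any default value will do. *)
Lemma strat_void A (x : A) (P : inst -> Prop) (Q : A -> nat -> inst -> Prop) : (forall I, ~ P I) -> strat P Q.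
Proof. by move=> H; exists (Ret x) => I /H. Qed.

(** Binary search: one query at the midpoint of [s] decides in which half [v] leaves the span as
    elements are deleted from [S] in order. *)
Lemma find_first o (S : {set V}) v L pre s : v \notin S -> size s <= 2 ^ L ->
  strat (fun I => [/\ S \in indep (mat I o),
      v \in span (mat I o) (S :\: [set x in pre]) &
      v \notin span (mat I o) (S :\: [set x in pre ++ s])])
    (fun u c I => c <= L /\ exists s1 s2, [/\ s = s1 ++ u :: s2,
      v \in span (mat I o) (S :\: [set x in pre ++ s1]) &
      v \notin span (mat I o) (S :\: [set x in pre ++ rcons s1 u])]).
Proof.
move=> vS; elim: L pre s => [|L IHL] pre s.
  case: s => [_|u [|//] _].
    by apply: (strat_void v) => I [_]; rewrite cats0 => ->.
  apply: (@strat_ret _ _ _ u) => I [Si v1 v2]; split=> //.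
  by exists [::], [::]; rewrite cats0.
rewrite expnS mul2n -addnn => le_s.
pose s1 := take (2 ^ L) s; pose s2 := drop (2 ^ L) s.
have es : s = s1 ++ s2 by rewrite cat_take_drop.
have l1 : size s1 <= 2 ^ L by rewrite size_take; case: ltnP; nlia.
have l2 : size s2 <= 2 ^ L by rewrite size_drop; nlia.
apply: (strat_span (o := o) (X := S :\: [set x in pre ++ s1]) (v := v)).
- by move=> I [Si _ _]; apply: indep_sub Si; apply: subsetDl.
- by rewrite inE (negbTE vS) andbF.
- apply: strat_conseq (IHL (pre ++ s1) s2 l2) _ _.
    by move=> I [[Si v1 v2] v3]; split=> //; rewrite -catA -es.
  move=> u c I _ [lec [t1 [t2 [e v1 v2]]]]; split=> //.
  by exists (s1 ++ t1), t2; split; rewrite -?catA -?e // ?rcons_cat catA.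
apply: strat_conseq (IHL pre s1 l1) _ _.
  by move=> I [[Si v1 v2] v3]; split.
move=> u c I _ [lec [t1 [t2 [e v1 v2]]]]; split=> //.
by exists t1, (t2 ++ s2); split=> //; rewrite es e -catA.
Qed.

(** Deleting [U] in increasing order of [p] turns the binary search into a minimisation, since [v]
    leaves the span with the first deleted member of its support. *)
Lemma find_min o (S : {set V}) v (p : V -> nat) (U : {set V}) L : v \notin S -> #|U| <= 2 ^ L ->
  strat (fun I => [/\ S \in indep (mat I o), v \in span (mat I o) S &
      v \notin span (mat I o) (S :\: U)])
    (fun u c I => [/\ c <= L, u \in U, u \in supp (mat I o) S v &
      forall x, x \in supp (mat I o) S v -> x \in U -> p u <= p x]).
Proof.
move=> vS leU.
pose s := sort (fun x y => p x <= p y) (enum U).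
have ss : sorted (fun x y => p x <= p y) s by apply: sort_sorted => x y; apply: leq_total.
have ms x : (x \in s) = (x \in U) by rewrite mem_sort mem_enum.
have sz : size s <= 2 ^ L by rewrite size_sort -cardE.
apply: strat_conseq (find_first o [::] vS sz) _ _ => [I [Si v1 v2]|u c I].
  split=> //; first by rewrite (_ : [set x in [::]] = set0) ?setD0 //; apply/setP=> x; rewrite !inE.
  by rewrite (_ : [set x in _] = U) //; apply/setP=> x; rewrite inE ms.
move=> [Si v1 v2] [lec [s1 [s2 [es w1 w2]]]].
have us : u \in s by rewrite es mem_cat mem_head orbT.
rewrite (mem_span_supp Si v1) ?subsetDl //= in w1; rewrite (mem_span_supp Si v1) ?subsetDl //= in w2.
have uNs1 x : x \in supp (mat I o) S v -> x \notin s1.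
  by move=> /(subsetP w1); rewrite !inE => /andP[].
split=> //; first by rewrite -ms.
  apply: contraR w2 => uN; apply/subsetP=> x xs; have := subsetP w1 x xs.
  rewrite !inE mem_rcons inE => /andP[/negbTE-> ->]; rewrite orbF andbT.
  by apply: contraNneq uN => <-.
move=> x xs; rewrite -ms es mem_cat (negbTE (uNs1 x xs)) /=.
have tr : transitive (fun x y => p x <= p y) by move=> a b d; apply: leq_trans.
move: ss; rewrite es => /(subseq_sorted tr (suffix_subseq s1 _)) /=.
rewrite (path_sortedE tr) => /andP[/allP H _].
by rewrite inE => /predU1P[->|/H].
Qed.

(** A single query tells whether the support still meets [U], and a binary search is made only if it
    does: L + 1 queries for each element found, and one for the final negative test. *)
Lemma explore o (S : {set V}) v (U : {set V}) L : v \notin S -> #|U| <= 2 ^ L ->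
  strat (fun I => [/\ S \in indep (mat I o), v \in span (mat I o) S & U \subset S])
    (fun F c I => F = supp (mat I o) S v :&: U /\ c <= 1 + #|F| * L.+1).
Proof.
move=> vS; have [n] := ubnP #|U|; elim: n U => // n IHn U ltn leU.
apply: (strat_span (o := o) (X := S :\: U) (v := v)).
- by move=> I [Si _ _]; apply: indep_sub Si; apply: subsetDl.
- by rewrite inE (negbTE vS) andbF.
- apply: (@strat_ret _ _ _ set0) => I [[Si vs US]]; rewrite (mem_span_supp Si vs) ?subsetDl //.
  rewrite subsetD => /andP[_ dU]; split; last by rewrite cards0.
  by apply/esym/eqP; rewrite setI_eq0.
apply: strat_bind.
  by apply: strat_conseq (find_min o (fun=> 0) vS leU) _ (fun u c I _ H => H) => I [[Si vs _]].
move=> u c; have [uU|uU] := boolP (u \in U); last first.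
  by apply: (strat_void set0) => I [_ [_ H _ _]].
have cU := cardsD1 u U; rewrite uU /= in cU.
apply: strat_bind (_ : strat _ (fun F d I => [/\ F = supp (mat I o) S v :&: (U :\ u), d <= 1 + #|F| * L.+1 & u \in supp (mat I o) S v /\ c <= L])) _.
  apply: strat_conseq (IHn (U :\ u) _ _) _ _; try by nlia.
    by move=> I [[[Si vs US] _] _]; split=> //; apply: subset_trans US; apply: subsetDl.
  by move=> F d I [_ [cL _ us _]] [-> led]; split.
move=> F d; apply: (@strat_ret _ _ _ (u |: F)) => I [_ [eF led [us cL]]]; split.
  apply/setP=> x; rewrite eF !in_setU1 !in_setI !in_setD1.
  by case: eqP => [->|_] /=; rewrite ?us ?uU.
have := cardsU1 u F; rewrite eF !inE eqxx !andbF /= -eF => ->; nlia.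
Qed.

End Strategy.

(** * Labelled augmenting paths *)

Section Labels.
Variable V : finType.
Implicit Types (S : {set V}) (p : V -> nat) (I : inst V).

Definition upper S p i := [set x in S | i <= p x].
Definition lower S p i := [set x in S | p x <= i].

Lemma upper_sub S p i : upper S p i \subset S.
Proof. by apply/subsetP=> x; rewrite inE => /andP[]. Qed.

Lemma lower_sub S p i : lower S p i \subset S.
Proof. by apply/subsetP=> x; rewrite inE => /andP[]. Qed.

Lemma upper_anti S p i j : i <= j -> upper S p j \subset upper S p i.
Proof. by move=> ij; apply/subsetP=> x; rewrite !inE => /andP[-> /=]; apply: leq_trans. Qed.

Lemma lower_mono S p i j : i <= j -> lower S p i \subset lower S p j.
Proof. by move=> ij; apply/subsetP=> x; rewrite !inE => /andP[-> /= h]; apply: leq_trans ij. Qed.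

Definition common I S := (S \in indep I.1) /\ (S \in indep I.2).

(* An augmenting path is read off backwards from the sink [z]: the M1-neighbour
   [u] of [z] of least label, then [par u], and so on.  Minimality of [p u] and
   [ar_lower] exclude shortcuts. *)
Record aug_ready S p (par : V -> V) z I : Prop := AugReady {
  ar_common : common I S;
  ar_lower : forall v, v \notin S -> p v < p z -> v \in span I.2 (lower S p (p v));
  ar_upper : forall v, v \notin S -> p v < p z \/ v = z ->
    v \notin span I.1 (upper S p (p v));
  ar_par : forall u, u \in S -> p u < p z ->
    [/\ par u \notin S, p (par u) = p u & par u \notin span I.2 (S :\ u)];
  ar_notin : z \notin S;
  ar_sink : z \notin span I.2 S
}.

Record augmented S p z S' I : Prop := Augmented {
  au_common : common I S';
  au_card : #|S'| = #|S|.+1;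
  au_upper : forall i, upper S p i \subset span I.1 (upper S' p i);
  au_lower : forall i, i < p z -> lower S p i \subset span I.2 (lower S' p i);
  (* only needed to carry [au_lower] through the induction *)
  au_lower_sink : forall i, p z <= i -> z |: lower S p i \subset span I.2 (lower S' p i)
}.

(** * One exchange at the sink end of an augmenting path *)

Section Push.
Variables (S : {set V}) (p : V -> nat) (par : V -> V) (z u : V) (I : inst V).
Hypothesis rdy : aug_ready S p par z I.
Hypotheses (z1 : z \in span I.1 S) (uz : p u < p z) (us : u \in supp I.1 S z).
Hypothesis umin : forall x, x \in supp I.1 S z -> p x < p z -> p u <= p x.

Let S' := z |: S :\ u.

Let uS : u \in S.
Proof. exact: subsetP (supp_sub _ _ _) _ us. Qed.

Let zS : z \notin S.
Proof. exact: ar_notin rdy. Qed.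

Let parS : par u \notin S.
Proof. by have [] := ar_par rdy uS uz. Qed.

Let ppar : p (par u) = p u.
Proof. by have [] := ar_par rdy uS uz. Qed.

Let par2 : par u \notin span I.2 (S :\ u).
Proof. by have [] := ar_par rdy uS uz. Qed.

Let par2S : par u \in span I.2 S.
Proof.
by apply: mem_span_mono (ar_lower rdy parS _); rewrite ?lower_sub ?ppar.
Qed.

Lemma push_upper i : i <= p u -> z \in span I.1 (upper S p i).
Proof.
have [Si1 _] := ar_common rdy.
move=> iu; rewrite (mem_span_supp Si1) ?upper_sub //; apply/subsetP=> x xs.
rewrite inE (subsetP (supp_sub _ _ _) _ xs) /=.
have [xz|] := ltnP (p x) (p z); first exact: leq_trans iu (umin xs xz).
by apply: leq_trans; apply: leq_trans iu (ltnW uz).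
Qed.

Lemma upper_push i : upper S' p i \subset span I.1 (upper S p i) \/ p u < i.
Proof.
have [|iu] := ltnP (p u) i; [by right | left].
apply/subsetP=> x; rewrite !inE => /andP[/predU1P[->|/andP[_ xS]] ix].
  exact: push_upper.
by have /mem_span : x \in upper S p i; rewrite ?inE ?xS.
Qed.

Lemma push_indep1 : S' \in indep I.1.
Proof.
have [Si1 _] := ar_common rdy.
apply: indep_setU1; first exact: indep_sub (subsetDl _ _) Si1.
by move: us; rewrite inE => /andP[].
Qed.

(** If [par u] were in the M2-span of [S'], exchange would put [z] in the span of [par u |: S :\ u],
    hence in that of [S], although [z] is a sink; the same argument protects the parents of lower
    label. In M1, minimality of [p u] places [z] in the span of every upper set it joins at levels
    up to [p u], so no such span grows. *)
Lemma push_ready : aug_ready S' p par (par u) I.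
Proof.
have [Si1 Si2] := ar_common rdy.
have z2 := ar_sink rdy.
have inS' x : x \notin S' -> p x < p z -> x <> u -> x \notin S.
  move=> xS' _ /eqP xu; apply: contraNN xS' => xS.
  by rewrite !inE xu xS orbT.
split.
- split; first exact: push_indep1.
  by apply: indep_sub (indep_setU1 Si2 z2); apply: setUS; apply: subsetDl.
- move=> v vS'; rewrite ppar => vu.
  have vS : v \notin S by apply: inS' => //; [apply: ltn_trans uz | move=> e; rewrite e ltnn in vu].
  apply: mem_span_mono (ar_lower rdy vS (ltn_trans vu uz)).
  apply/subsetP=> x; rewrite !inE => /andP[xS xv]; rewrite xS xv !andbT.
  by case: eqP => //= e; have := leq_ltn_trans xv vu; case: eqP => // ->; rewrite ltnn.
- move=> v vS' hv.
  have vu : p v <= p u by rewrite -ppar; case: hv => [/ltnW//|->].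
  have vS : v \notin S.
    case: hv => [vu'|-> //]; apply: inS' => //; first exact: leq_ltn_trans uz.
    by move=> e; rewrite e ppar ltnn in vu'.
  have := ar_upper rdy vS (or_introl (leq_ltn_trans vu uz)).
  apply: contraNN; apply: mem_span_sub.
  by have [//|] := upper_push (p v); rewrite ltnNge vu.
- move=> x; rewrite !inE ppar => /predU1P[->|/andP[xu xS]] xlt.
    by have := ltn_trans xlt uz; rewrite ltnn.
  have [px1 px2 px3] := ar_par rdy xS (ltn_trans xlt uz).
  split=> //.
    rewrite negb_or (negbTE px1) andbF andbT; apply: contraTN uz => /eqP <-.
    by rewrite px2 -leqNgt ltnW.
  apply: contraNN z2 => h.
  have zx : z != x by apply: contraNneq zS => ->.
  have e : (z |: S :\ u) :\ x = z |: (S :\ x) :\ u.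
    apply/setP=> y; rewrite !inE; case: (y =P z) => [->|] /=; first by rewrite zx.
    by move=> _; rewrite andbCA.
  move: h; rewrite -/S' /S' e => /span_exchange h.
  have /h : par x \notin span I.2 (S :\ x :\ u).
    by apply: contraNN px3; apply: mem_span_mono; apply: subsetDl.
  apply: mem_span_sub; rewrite subUset sub1set; apply/andP; split.
    apply: mem_span_mono (ar_lower rdy px1 _); rewrite ?lower_sub //.
    by rewrite px2 (ltn_trans xlt).
  by apply: subset_trans (sub_span _ _); exact: subset_trans (subsetDl _ _) (subsetDl _ _).
- rewrite !inE negb_or (negbTE parS) andbF andbT.
  by apply: contraTN uz => /eqP <-; rewrite ppar ltnn.
apply: contraNN z2 => /span_exchange/(_ par2); apply: mem_span_sub.
by rewrite subUset sub1set par2S; apply: subset_trans (sub_span _ _); apply: subsetDl.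
Qed.

(** The removed [u] stays spanned: in M1 by [z] and the other elements of an upper set, in M2 by
    [par u] and the other elements of a lower set. The inclusions for the rest of the path, whose
    sink is [par u], then finish. *)
Lemma push_augmented T : augmented S' p (par u) T I -> augmented S p z T I.
Proof.
case; rewrite ppar => cT kT upT loT loT'.
have lowpar i : p u <= i -> lower S p i \subset span I.2 (par u |: lower S' p i).
  move=> ui; apply/subsetP=> x; rewrite !inE => /andP[xS xi].
  have [->|xu] := eqVneq x u.
    have : u \in span I.2 (par u |: lower S p i :\ u).
      apply: span_swap; rewrite ?inE ?uS ?ui //.
        apply: mem_span_mono (ar_lower rdy parS _); rewrite ?ppar // lower_mono //.
      apply: contraNN par2; apply: mem_span_mono; apply: setSD; exact: lower_sub.
    apply: mem_span_mono; apply: setUS; apply/subsetP=> y.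
    by rewrite !inE => /and3P[-> -> ->]; rewrite orbT.
  by apply: mem_span; rewrite !inE xu xS xi !orbT.
split=> //.
- rewrite kT /S' cardsU1 !inE negb_and zS orbT /= add1n.
  by rewrite [in RHS](cardsD1 u S) uS.
- move=> i; have [ui|iu] := leqP i (p u); last first.
    apply: subset_trans (span_subP (upT i)); apply: subset_trans (sub_span _ _).
    apply/subsetP=> x; rewrite !inE => /andP[xS ix]; rewrite xS ix !andbT.
    by apply/orP; right; apply: contraTneq iu => <-; rewrite -leqNgt.
  apply: subset_trans (span_subP (upT i)).
  apply/subsetP=> x xi; have [->|xu] := eqVneq x u; last first.
    by apply: mem_span; move: xi; rewrite !inE xu => /andP[-> ->]; rewrite !orbT.
  have : u \in span I.1 (z |: upper S p i :\ u).
    apply: span_swap; rewrite ?push_upper ?inE ?uS //.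
    move: us; rewrite inE uS /=; apply: contraNN; apply: mem_span_mono.
    by apply: setSD; apply: upper_sub.
  apply: mem_span_mono; apply/subsetP=> y; rewrite !inE => /predU1P[->|/and3P[-> -> ->]].
    by rewrite eqxx /= (leq_trans ui (ltnW uz)).
  by rewrite orbT.
- move=> i iz; have [ui|iu] := leqP (p u) i.
    by apply: subset_trans (lowpar i ui) _; apply: span_subP; apply: loT'.
  apply: subset_trans (loT i iu); apply/subsetP=> x; rewrite !inE => /andP[xS xi].
  rewrite xS xi !andbT; apply/orP; right.
  by apply: contraTneq iu => <-; rewrite -leqNgt.
move=> i zi; have ui := leq_trans (ltnW uz) zi.
rewrite subUset sub1set; apply/andP; split.
  apply: (mem_span_sub (loT' i ui)); apply: mem_span.
  by rewrite !inE eqxx zi orbT.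
by apply: subset_trans (lowpar i ui) _; apply: span_subP; apply: loT'.
Qed.

End Push.

(** Each exchange moves the sink to the smaller label [p u], so the elements of [S] below the sink
    strictly decrease in number, which pays for one test and one binary search per exchange. *)
Lemma augment S p par z L : #|S| <= 2 ^ L ->
  strat (aug_ready S p par z)
    (fun S' c I => augmented S p z S' I /\ c <= #|[set u in S | p u < p z]|.+1 * L.+1).
Proof.
have [n] := ubnP (p z); elim: n S z => // n IHn S z ltn leS.
have [zS|zS] := boolP (z \in S).
  by apply: (strat_void set0) => I /ar_notin; rewrite zS.
apply: (strat_span (o := Oracle1) (X := S) (v := z)) => //.
- by move=> I /ar_common[].
- pose U := [set u in S | p u < p z].
  have eU : S :\: U = upper S p (p z).
    by apply/setP=> x; rewrite !inE; case: (x \in S); rewrite //= ?andbT ?andbF -leqNgt.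
  have leU : #|U| <= 2 ^ L.
    by apply: leq_trans leS; apply/subset_leq_card/subsetP=> x; rewrite inE => /andP[].
  apply: strat_bind.
    apply: strat_conseq (find_min Oracle1 p zS leU) _ (fun u c I _ H => H) => I [rdy z1].
    by split=> //; [case: (ar_common rdy) | rewrite eU; apply: (ar_upper rdy) => //; right].
  move=> u c; have [uU|uU] := boolP (u \in U); last first.
    by apply: (strat_void set0) => I [_ [_ H _ _]].
  have [parz|parz] := ltnP (p (par u)) (p z); last first.
    apply: (strat_void set0) => I [[rdy z1] [_ _ _ _]].
    move: uU; rewrite inE => /andP[uS uz].
    by have [_ h _] := ar_par rdy uS uz; rewrite h leqNgt uz in parz.
  have /andP[uS uz] : (u \in S) && (p u < p z) by move: uU; rewrite inE.
  have cS : #|z |: S :\ u| = #|S|.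
    by rewrite cardsU1 !inE negb_and zS orbT /= [RHS](cardsD1 u S) uS.
  apply: strat_conseq (IHn (z |: S :\ u) (par u) _ _) _ _; rewrite ?cS //.
  + exact: leq_trans parz ltn.
  + move=> I [[rdy z1] [_ _ us umin]]; apply: push_ready rdy z1 uz us _ => x xs xz.
    by apply: umin => //; rewrite inE (subsetP (supp_sub _ _ _) _ xs).
  move=> T d I [[rdy z1] [cL _ us umin]] [aT dle]; split.
    apply: push_augmented rdy z1 uz us _ _ aT => x xs xz.
    by apply: umin => //; rewrite inE (subsetP (supp_sub _ _ _) _ xs).
  suff lt : #|[set u0 in z |: S :\ u | p u0 < p (par u)]| < #|U|.
    by have := leq_mul lt (leqnn L.+1); rewrite -/U; nlia.
  apply/proper_card/properP; split; last first.
    exists u => //; rewrite !inE eqxx /= orbF.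
    by apply: contraNN zS => /andP[/eqP<- _].
  have [_ e _] := ar_par rdy uS uz.
  apply/subsetP=> x; rewrite !inE => /andP[/predU1P[->|/andP[_ ->]]].
    by move/ltn_trans => /(_ _ parz); rewrite ltnn.
  by move/ltn_trans; apply.
apply: (@strat_ret _ _ _ _ (z |: S)) => I [rdy z1]; split; last by nlia.
have [Si1 Si2] := ar_common rdy.
split.
- by split; apply: indep_setU1 => //; apply: ar_sink rdy.
- by rewrite cardsU1 zS.
- move=> i; apply: subset_trans (sub_span _ _); apply/subsetP=> x.
  by rewrite !inE => /andP[-> ->]; rewrite orbT.
- move=> i _; apply: subset_trans (sub_span _ _); apply/subsetP=> x.
  by rewrite !inE => /andP[-> ->]; rewrite orbT.
move=> i zi; apply: subset_trans (sub_span _ _); apply/subsetP=> x.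
by rewrite !inE => /predU1P[->|/andP[-> ->]]; rewrite ?eqxx ?zi ?orbT.
Qed.

(** Weak duality for matroid intersection, with spanning sets in place of ranks. Every approximation
    or optimality claim below is an instance of it. *)
Lemma card_common_le I T A B X Y : common I T -> A :|: B = [set: V] ->
  A \subset span I.1 X -> B \subset span I.2 Y -> #|T| <= #|X| + #|Y|.
Proof.
move=> [T1 T2] AB AX BY.
have l1 : #|T :&: A| <= #|X|.
  apply: (@leq_card_span _ I.1); first exact: indep_sub (subsetIl _ _) T1.
  by apply: subset_trans AX; apply: subsetIr.
have l2 : #|T :&: B| <= #|Y|.
  apply: (@leq_card_span _ I.2); first exact: indep_sub (subsetIl _ _) T2.
  by apply: subset_trans BY; apply: subsetIr.
have -> : T = (T :&: A) :|: (T :&: B) by rewrite -setIUr AB setIT.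
by apply: leq_trans (leq_card_setU _ _) _; apply: leq_add.
Qed.

(* Averages over the [l] cuts; the part of [S] counted twice by the cut at [j] is
   its level [j]. *)
Lemma level_bound I T S K p l : common I T ->
  (forall j, j < l -> [set x | j < p x] \subset span I.1 (upper S p j)) ->
  (forall j, j < l -> [set x | p x <= j] \subset span I.2 (lower S p j :|: K)) ->
  l * #|T| <= l * (#|S| + #|K|) + #|S|.
Proof.
move=> cT up lo.
have step j : j < l -> #|T| <= (#|S| + #|K|) + #|[set x in S | p x == j]|.
  move=> jl; apply: leq_trans (card_common_le cT _ (up j jl) (lo j jl)) _.
    by apply/setP=> x; rewrite !inE; case: leqP.
  have := leq_of_leqif (leq_card_setU (lower S p j) K).
  have := cardsUI (upper S p j) (lower S p j).
  have -> : upper S p j :|: lower S p j = S.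
    by apply/setP=> x; rewrite !inE; case: (x \in S) => //=; case: leqP => // /ltnW.
  have -> : upper S p j :&: lower S p j = [set x in S | p x == j].
    by apply/setP=> x; rewrite !inE; case: (x \in S) => //=; rewrite eqn_leq andbC.
  nlia.
have : \sum_(j < l) #|T| <= \sum_(j < l) ((#|S| + #|K|) + #|[set x in S | p x == j]|).
  by apply: leq_sum => j _; apply: step.
rewrite big_split /= !sum_nat_const card_ord => /leq_trans; apply.
rewrite leq_add2l.
have -> : \sum_(j < l) #|[set x in S | p x == j]| = \sum_(x in S) \sum_(j < l) (p x == j).
  rewrite exchange_big; apply: eq_bigr => j _.
  by rewrite -sum1_card big_mkcond [RHS]big_mkcond; apply: eq_bigr => x _; rewrite inE; case: (x \in S); case: eqP.
rewrite -sum1_card; apply: leq_sum => x _.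
have [xl|lx] := ltnP (p x) l.
  rewrite (bigD1 (Ordinal xl)) //= eqxx big1 ?addn0 // => j /eqP jx.
  by case: eqP => // e; case: jx; apply: val_inj.
by rewrite big1 // => j _; case: eqP => // e; have := ltn_ord j; rewrite -e ltnNge lx.
Qed.

End Labels.

(** * Reachability with light and heavy elements *)

Section Reach.
Variable V : finType.
Variables (S Z : {set V}) (L h tau : nat).
Hypotheses (leS : #|S| <= 2 ^ L) (h_gt0 : 0 < h) (tau_gt0 : 0 < tau).
Hypothesis ZS : Z \subset ~: S.
Implicit Types (I : inst V) (p : V -> nat) (par : V -> V) (K G : V -> {set V}) (Lt : {set V}).

(** [N] holds the non-sinks outside [S] and [big] is the label of an unreached element. An element
    of [S] is saturated when it occurs in [tau] lists; [X0] bounds the number of unreached saturated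
    elements and [B0] the queries that make one element light. *)
Let N := ~: (S :|: Z).
Let big := #|V|.+1.
Let E := L.+1.
Let X0 := (#|V| * h) %/ tau.
Let B0 := 2 + X0 * E.

Definition sinks_ok I := common I S /\
  forall v, v \notin S -> (v \in Z) = (v \notin span I.2 S).

Definition reached p := [set u in S | p u < big].

(* [K v] collects neighbours of [v], with each neighbour in at most [tau] lists.
   Once the unknown neighbours of [v] can only be saturated elements, [v] enters
   [Lt] and [G v] records all its unreached neighbours. *)
Record lists_ok I p K G (Lt : {set V}) : Prop := ListsOk {
  lo_supp : forall v, v \in N -> K v \subset supp I.2 S v;
  lo_out : forall v, v \notin N -> K v = set0;
  lo_light : forall v, v \in Lt ->
    [/\ v \in N, G v \subset supp I.2 S v & supp I.2 S v \subset G v :|: reached p];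
  lo_small : forall v, #|K v :\: reached p| <= h;
  lo_deg : forall u, #|[set v | u \in K v]| <= tau
}.

Lemma inN v : (v \in N) = (v \notin S) && (v \notin Z).
Proof. by rewrite !inE negb_or. Qed.

Definition settled p K (Lt : {set V}) v := (v \in Lt) || (h <= #|K v :\: reached p|).

Definition list_weight K := \sum_v #|K v|.

Lemma sum_deg K (W : {set V}) :
  \sum_(u in W) #|[set v | u \in K v]| = \sum_v #|K v :&: W|.
Proof.
transitivity (\sum_(u in W) \sum_v (u \in K v : nat)).
  apply: eq_bigr => u _; rewrite -sum1_card big_mkcond; apply: eq_bigr => v _.
  by rewrite inE; case: (u \in K v).
rewrite exchange_big; apply: eq_bigr => v _.
rewrite -sum1_card big_mkcond [RHS]big_mkcond; apply: eq_bigr => u _.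
by rewrite inE; case: (u \in K v); case: (u \in W).
Qed.

Lemma list_weight_le I p K G Lt : lists_ok I p K G Lt -> list_weight K <= #|S| * tau.
Proof.
move=> ok; have e : list_weight K = \sum_(u in S) #|[set v | u \in K v]|.
  rewrite sum_deg; apply: eq_bigr => v _; rewrite (setIidPl _) //.
  have [/(lo_supp ok)/subset_trans->//|/(lo_out ok)->] := boolP (v \in N).
    exact: supp_sub.
  exact: sub0set.
rewrite e -sum_nat_const; apply: leq_sum => u _; exact: lo_deg ok u.
Qed.

(** Double counting of occurrences: each of the |V| lists contains at most [h] unreached elements,
    and each member of [W] lies in at least [tau] lists. *)
Lemma saturated_card I p K G Lt (W : {set V}) : lists_ok I p K G Lt ->
  W \subset ~: reached p -> (forall u, u \in W -> tau <= #|[set v | u \in K v]|) ->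
  #|W| <= X0.
Proof.
move=> ok WR Wt; rewrite /X0 leq_divRL //.
rewrite -[leqLHS]sum_nat_const.
apply: (@leq_trans (\sum_(u in W) #|[set v | u \in K v]|)); first exact: leq_sum.
rewrite sum_deg.
apply: leq_trans (_ : \sum_(v : V) h <= _); last by rewrite sum_nat_const cardT -cardE.
apply: leq_sum => v _; apply: leq_trans (lo_small ok v).
by apply: subset_leq_card; rewrite setDE setIS.
Qed.

Definition listing := ((V -> {set V}) * (V -> {set V}) * {set V})%type.

(** An amortised bound: every new list entry pays [E] and every new light element pays [B0]. Both
    quantities only grow and are bounded over the whole search, so the repeated refills need no
    separate count. *)
Lemma refill_one p v K G Lt : v \in N -> v \notin Lt ->
  strat (fun I => sinks_ok I /\ lists_ok I p K G Lt)
    (fun (r : listing) c I => [/\ lists_ok I p r.1.1 r.1.2 r.2,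
      (forall w, (w == v) || settled p K Lt w -> settled p r.1.1 r.2 w) &
      c + E * list_weight K + B0 * #|Lt| <= E * list_weight r.1.1 + B0 * #|r.2|]).
Proof.
move=> vN vLt; have [n] := ubnP (h - #|K v :\: reached p|).
elim: n K => // n IHn K ltn.
have /andP[vS vZ] : (v \notin S) && (v \notin Z) by rewrite -inN.
have [hK|Kh] := leqP h #|K v :\: reached p|.
  apply: (@strat_ret _ _ _ _ (K, G, Lt)) => I [_ ok]; split=> // w /orP[/eqP->|//].
  by rewrite /settled hK orbT.
pose R := reached p; pose Sat := [set u | tau <= #|[set w | u \in K w]|].
pose U := S :\: R :\: K v :\: Sat.
have US : U \subset S by rewrite !(subset_trans (subsetDl _ _)).
have leU : #|U| <= 2 ^ L by apply: leq_trans leS; apply: subset_leq_card.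
have span_v I : sinks_ok I -> v \in span I.2 S.
  by case=> _ /(_ v vS); rewrite (negbTE vZ) => /esym/negbFE.
apply: (strat_span (o := Oracle2) (X := S :\: U) (v := v)).
- by move=> I [[[_ Si] _] _]; apply: indep_sub Si; apply: subsetDl.
- by rewrite inE (negbTE vS) andbF.
(* No unsaturated candidate is left, so the unreached neighbours missing from [K v] are saturated;
   there are at most [X0] of them and all are listed now. *)
- pose W := (S :\: R :\: K v) :&: Sat.
  have WS : W \subset S by rewrite subIset // !(subset_trans (subsetDl _ _)).
  have leW : #|W| <= 2 ^ L by apply: leq_trans leS; apply: subset_leq_card.
  apply: strat_bind.
    apply: strat_conseq (explore Oracle2 vS leW) _ (fun F c I _ H => H).
    by move=> I [[zok ok] _]; split=> //; [case: zok => [[]]|apply: span_v].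
  move=> F c; pose G' := fun w => if w == v then K v :|: F else G w.
  apply: (@strat_ret _ _ _ _ (K, G', v |: Lt)) => I [[[zok ok] vU] [eF lec]].
  have [[_ Si2] _] := zok.
  have leF : #|F| <= X0.
    apply: leq_trans (saturated_card ok (W := W) _ _); first by rewrite eF subset_leq_card ?subsetIr.
      by apply/subsetP=> u; rewrite !inE => /andP[/and3P[_ h1 _] _].
    by move=> u; rewrite !inE => /andP[].
  split=> /=; last first.
  + by rewrite cardsU1 vLt /= mulnDr muln1 /B0; have := leq_mul leF (leqnn E); rewrite -/E in lec; nlia.
  + move=> w /orP[/eqP->|]; rewrite /settled !inE ?eqxx //.
    by case/orP=> ->; rewrite ?orbT.
  case: (ok) => k1 k2 k3 k4 k5; split=> //.
  move=> w; rewrite /G' in_setU1; case: eqP => [-> _|_ /= /k3 //].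
  split=> //; first by rewrite subUset k1 //= eF subsetIl.
  rewrite (mem_span_supp Si2 (span_v I zok)) ?subsetDl // in vU.
  apply/subsetP=> u us; have := subsetP vU u us.
  rewrite !inE eF in_setI us !inE (subsetP (supp_sub _ _ _) u us) /= -/(reached p) !andbT.
  by rewrite negb_and; case: (u \in K v) => //=; rewrite -ltnNge; case: (p u < big) => //=; case: leqP.
apply: strat_bind.
  apply: strat_conseq (find_min Oracle2 (fun=> 0) vS leU) _ (fun u c I _ H => H).
  by move=> I [[zok ok] vU]; split=> //; [case: zok => [[]]|apply: span_v].
move=> u c; have [uU|uU] := boolP (u \in U); last first.
  by apply: (strat_void (K, G, Lt)) => I [_ [_ H _ _]].
pose K' := fun w => if w == v then u |: K v else K w.
have /and4P[uSat uK uR uS] : [&& u \notin Sat, u \notin K v, u \notin R & u \in S].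
  by move: uU; rewrite !inE => /and4P[-> -> -> ->].
have cK : #|K' v :\: R| = #|K v :\: R|.+1.
  rewrite /K' eqxx setDUl (setDidPl _) ?disjoints1 // -/R.
  by rewrite cardsU1 inE negb_and uK orbT.
have wK : list_weight K' = (list_weight K).+1.
  rewrite /list_weight (bigD1 v) //= [in RHS](bigD1 v) //= /K' eqxx cardsU1 uK.
  by rewrite (eq_bigr (fun w => #|K w|)) // => w /negbTE->.
apply: strat_conseq (IHn K' _) _ _; first by rewrite -/R in ltn Kh *; rewrite cK; nlia.
  move=> I [[[zok ok] vU] [cL _ us _]]; split=> //.
  case: (ok) => k1 k2 k3 k4 k5; split=> //.
  - move=> w wN; rewrite /K'; case: eqP => [->|_]; last exact: k1.
    by rewrite subUset sub1set k1 // andbT; exact: us.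
  - by move=> w wN; rewrite /K'; case: eqP wN => [->|_ /k2 //]; rewrite vN.
  - move=> w; have [->|wv] := eqVneq w v; first by rewrite -/R cK.
    by rewrite /K' (negbTE wv).
  move=> u'; have [eu|nu] := eqVneq u' u; last first.
    apply: leq_trans (k5 u'); apply: subset_leq_card; apply/subsetP=> w; rewrite !inE /K'.
    by case: eqP => [->|//]; rewrite !inE (negbTE nu).
  rewrite eu; apply: leq_trans (_ : #|v |: [set w | u \in K w]| <= tau).
    apply: subset_leq_card; apply/subsetP=> w; rewrite !inE /K'.
    by case: eqP.
  have ltA : #|[set w | u \in K w]| < tau by move: uSat; rewrite !inE -ltnNge.
  by rewrite cardsU1; apply: leq_trans ltA; rewrite -add1n leq_add2r leq_b1.
move=> [[K2 G2] Lt2] d I [[[zok ok] vU] [cL _ us _]] /= [ok2 st le2]; split=> //.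
  move=> w hw; apply: st; have [//|wv] := eqVneq w v.
  by move: hw; rewrite /settled (negbTE wv) /= /K' (negbTE wv).
by rewrite wK mulnS in le2; rewrite -/E in le2 *; rewrite /E in le2 *; nlia.
Qed.

Lemma refill p K G Lt :
  strat (fun I => sinks_ok I /\ lists_ok I p K G Lt)
    (fun (r : listing) c I => [/\ lists_ok I p r.1.1 r.1.2 r.2,
      (forall w, w \in N -> settled p r.1.1 r.2 w) &
      c + E * list_weight K + B0 * #|Lt| <= E * list_weight r.1.1 + B0 * #|r.2|]).
Proof.
suff H (s : seq V) : strat (fun I => sinks_ok I /\ lists_ok I p K G Lt)
    (fun (r : listing) c I => [/\ lists_ok I p r.1.1 r.1.2 r.2,
      (forall w, (w \in N) && (w \in s) || settled p K Lt w -> settled p r.1.1 r.2 w) &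
      c + E * list_weight K + B0 * #|Lt| <= E * list_weight r.1.1 + B0 * #|r.2|]).
  apply: strat_conseq (H (enum V)) _ _ => // r c I _ [r1 r2 r3]; split=> // w wN.
  by apply: r2; rewrite wN mem_enum.
elim: s K G Lt => [|v s IHs] K G Lt.
  by apply: (@strat_ret _ _ _ _ (K, G, Lt)) => I [_ ok]; split=> // w; rewrite andbF.
have [/andP[vN vLt]|skip] := boolP ((v \in N) && (v \notin Lt)); last first.
  apply: strat_conseq (IHs K G Lt) _ _ => // r c I _ [r1 r2 r3]; split=> // w hw; apply: r2.
  case/orP: hw => [/andP[wN]|->]; last by rewrite orbT.
  rewrite inE => /predU1P[e|->]; last by rewrite wN.
  by move: skip; rewrite -e wN /settled /= negbK => ->; rewrite orbT.
apply: strat_bind (refill_one p K G vN vLt) _ => -[[K1 G1] Lt1] c /=.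
apply: strat_conseq (IHs K1 G1 Lt1) _ _; first by move=> I [[zok _] [ok1 _ _]].
move=> r d I [_ [_ s1 le1]] [r1 r2 le2]; split=> //; last by nlia.
move=> w hw; apply: r2; case/orP: hw => [/andP[wN]|ws]; last by rewrite s1 ?ws ?orbT.
by rewrite inE => /predU1P[->|->]; [rewrite s1 ?eqxx ?orbT|rewrite wN].
Qed.

(* Elements are stamped with the time at which they are reached ([big] before),
   and all neighbours of an element get its stamp at once.  This makes the stamps
   valid labels for [augment]. *)
Record search_ok I p par t : Prop := SearchOk {
  so_label : forall x, (p x < t) || (p x == big);
  so_time : t <= #|[set v in ~: S | p v < big]|;
  so_lower : forall v, v \notin S -> p v < big -> v \in span I.2 (lower S p (p v));
  so_upper : forall v, v \notin S -> p v < big -> v \notin span I.1 (upper S p (p v));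
  so_par : forall u, u \in S -> p u < big ->
    [/\ par u \notin S, p (par u) = p u & par u \notin span I.2 (S :\ u)]
}.

Lemma search_time I p par t : search_ok I p par t -> t < big.
Proof. by move=> ok; rewrite ltnS; apply: leq_trans (so_time ok) (max_card _). Qed.

Lemma lower_reached p i : i < big -> lower S p i \subset reached p.
Proof. by move=> ib; apply/subsetP=> x; rewrite !inE => /andP[-> h1] /=; apply: leq_ltn_trans ib. Qed.

Lemma search_supp I p par t v : common I S -> search_ok I p par t -> v \notin S -> p v < big ->
  supp I.2 S v \subset reached p.
Proof.
move=> [_ Si2] ok vS vb; have vl := so_lower ok vS vb.
apply: subset_trans (lower_reached _ vb).
by rewrite -(mem_span_supp Si2) ?lower_sub // (mem_span_mono (lower_sub _ _ _) vl).
Qed.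

Definition mark p x (F : {set V}) t y := if (y == x) || (y \in F) then t else p y.
Definition mark_par par x (F : {set V}) (y : V) : V := if y \in F then x else par y.

(** * Stamping a new element and its unreached neighbours *)

Section Mark.
Variables (I : inst V) (p : V -> nat) (par : V -> V) (t : nat) (x : V) (F : {set V}).
Hypotheses (SI : common I S) (ok : search_ok I p par t).
Hypotheses (xS : x \notin S) (xb : p x = big) (x1 : x \notin span I.1 (S :\: reached p)).
Hypotheses (x2 : x \in span I.2 S).
Hypotheses (FR : F \subset S :\: reached p) (Fs : F \subset supp I.2 S x).
Hypothesis sF : supp I.2 S x \subset reached p :|: F.

Let p' := mark p x F t.

Let tb : t < big.
Proof. exact: search_time ok. Qed.

Let FS y : y \in F -> [/\ y \in S, big <= p y & y != x].
Proof.
move=> /(subsetP FR); rewrite !inE => /andP[h1 yS]; rewrite yS in h1 *.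
by rewrite -leqNgt in h1; split=> //; apply: contraTneq yS => ->.
Qed.

Let markE y : p y < big -> p' y = p y.
Proof.
move=> yb; rewrite /p' /mark; case: eqP => [e|_] /=; first by rewrite e xb ltnn in yb.
by case: ifP => // /FS[_]; rewrite leqNgt yb.
Qed.

Let mark_x : p' x = t.
Proof. by rewrite /p' /mark eqxx. Qed.

Let mark_big y : p' y < big -> [\/ p y < t /\ p' y = p y, y = x | y \in F].
Proof.
rewrite {1}/p' /mark; case: eqP => [->|_] /=; first by constructor 2.
case: ifP => [|_ yb]; first by constructor 3.
by constructor 1; split; [case/orP: (so_label ok y) => // /eqP e; rewrite e ltnn in yb|apply: markE].
Qed.

Let small y : p y < t -> p y < big.
Proof. by move=> yt; apply: ltn_trans tb. Qed.

Lemma upper_mark i : i < t -> upper S p' i = upper S p i.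
Proof.
move=> it; apply/setP=> y; rewrite !inE; case: (boolP (y \in S)) => //= yS.
have yx : y != x by apply: contraNneq xS => <-.
rewrite /p' /mark (negbTE yx) /=; case: ifP => // /FS[_ yb _].
by rewrite (ltnW it) (leq_trans (ltnW (ltn_trans it tb))).
Qed.

Lemma upper_mark_t : upper S p' t \subset S :\: reached p.
Proof.
apply/subsetP=> y; rewrite !inE => /andP[yS]; rewrite yS andbT /= -leqNgt => ty.
rewrite leqNgt; apply/negP => yb; rewrite markE // in ty.
by case/orP: (so_label ok y) => [|/eqP e]; [rewrite ltnNge ty | rewrite e ltnn in yb].
Qed.

Lemma lower_mark i : i < t -> lower S p i \subset lower S p' i.
Proof.
move=> it; apply/subsetP=> y; rewrite !inE => /andP[-> yi] /=.
by rewrite markE // (leq_ltn_trans yi) // (ltn_trans it).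
Qed.

(** All earlier stamps are below [t], so the upper set at [t] consists of previously unreached
    elements and cannot span [x] in M1, while the lower set at [t] contains the whole M2-support of
    [x]. Conditions at earlier stamps concern levels that the new stamp does not damage. *)
Lemma mark_ready : search_ok I p' (mark_par par x F) t.+1.
Proof.
split.
- move=> y; case: (ltnP (p' y) big) => [/mark_big[[yt e]|->|yF]|yb].
  + by rewrite e ltnS (ltnW yt).
  + by rewrite mark_x leqnn.
  + by rewrite /p' /mark yF orbT leqnn.
  + apply/orP; right; rewrite /p' /mark in yb *; case: ifP yb => [_|_ yb].
      by rewrite leqNgt tb.
    by case/orP: (so_label ok y) => // yt; have := small yt; rewrite ltnNge yb.
- apply: leq_ltn_trans (so_time ok) _; apply: proper_card; apply/properP; split.
    by apply/subsetP=> y; rewrite !inE => /andP[-> yb] /=; rewrite markE.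
  by exists x; rewrite !inE xS //= ?mark_x // xb ltnn.
- move=> v vS /mark_big[[vt e]|->|/FS[]]; last by rewrite (negbTE vS).
    rewrite e; apply: mem_span_mono (so_lower ok vS (small vt)).
    exact: lower_mark.
  rewrite mark_x; have [_ Si2] := SI.
  rewrite (mem_span_supp Si2 x2) ?lower_sub //; apply: subset_trans sF _.
  rewrite subUset; apply/andP; split; apply/subsetP=> y.
    rewrite !inE => /andP[-> yb] /=; rewrite markE //.
    by case/orP: (so_label ok y) => [/ltnW //|/eqP e]; rewrite e ltnn in yb.
  by move=> yF; have [yS _ _] := FS yF; rewrite inE yS /p' /mark yF orbT /=.
- move=> v vS /mark_big[[vt e]|->|/FS[]]; last by rewrite (negbTE vS).
    by rewrite e upper_mark // (so_upper ok vS (small vt)).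
  by rewrite mark_x; apply: contraNN x1; apply: mem_span_mono upper_mark_t.
move=> u uS /mark_big[[ut e]|eu|uF].
- have [h1 h2 h3] := so_par ok uS (small ut).
  have uF : u \notin F by apply/negP=> /FS[_]; rewrite leqNgt (small ut).
  by rewrite /mark_par (negbTE uF); split=> //; rewrite e -h2 markE // h2 small.
- by rewrite eu (negbTE xS) in uS.
rewrite /mark_par uF; split=> //; first by rewrite mark_x /p' /mark uF orbT.
by have := subsetP Fs u uF; rewrite inE => /andP[].
Qed.

Lemma reached_mark : reached p' = reached p :|: F.
Proof.
apply/setP=> y; rewrite !inE; case: (boolP (y \in S)) => yS /=; last first.
  by apply/esym/negbTE; apply: contraNN yS => /FS[].
have yx : y != x by apply: contraNneq xS => <-.
rewrite /p' /mark (negbTE yx) /=; case: ifP => _; rewrite ?orbF ?orbT //.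
Qed.

End Mark.

Lemma sink_ready I p par t z : common I S -> search_ok I p par t -> z \notin S -> p z = big ->
  z \notin span I.1 (S :\: reached p) -> z \notin span I.2 S ->
  aug_ready S (mark p z set0 t) par z I.
Proof.
move=> cS ok zS zb z1 z2; have tb := search_time ok.
have e y : y != z -> mark p z set0 t y = p y by rewrite /mark inE orbF => /negbTE->.
have ez : mark p z set0 t z = t by rewrite /mark eqxx.
have eS y : y \in S -> mark p z set0 t y = p y by move=> yS; apply: e; apply: contraNneq zS => <-.
have eu i : upper S (mark p z set0 t) i = upper S p i.
  by apply/setP=> y; rewrite !inE; case: (boolP (y \in S)) => //= /eS->.
have el i : lower S (mark p z set0 t) i = lower S p i.
  by apply/setP=> y; rewrite !inE; case: (boolP (y \in S)) => //= /eS->.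
split=> //; rewrite ?ez.
- move=> v vS; have [->|vz] := eqVneq v z; first by rewrite ez ltnn.
  by rewrite e // el => vt; apply: so_lower ok _ vS (ltn_trans vt tb).
- move=> v vS; rewrite eu; have [->|vz] := eqVneq v z.
    rewrite ez => _; apply: contraNN z1; apply: mem_span_mono.
    apply/subsetP=> y; rewrite !inE => /andP[-> ty]; rewrite andbT /= -leqNgt.
    by case/orP: (so_label ok y) => [|/eqP-> //]; rewrite ltnNge ty.
  by case=> [|/eqP]; rewrite ?(negbTE vz) // e // => vt; apply: so_upper ok _ vS (ltn_trans vt tb).
move=> u uS; rewrite eS // => ut; have [h1 h2 h3] := so_par ok uS (ltn_trans ut tb).
split=> //; rewrite e //; apply: contraTneq ut => pz.
by rewrite -h2 pz zb -leqNgt ltnW.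
Qed.

Lemma lists_ok_mono I p p' K G Lt : reached p \subset reached p' ->
  lists_ok I p K G Lt -> lists_ok I p' K G Lt.
Proof.
move=> pp' [k1 k2 k3 k4 k5]; split=> // v.
  by move=> /k3[h1 h2 h3]; split=> //; apply: subset_trans h3 (setUS _ pp').
by apply: leq_trans (k4 v); apply: subset_leq_card; apply: setDS.
Qed.

(** The two kinds of goals of the backward search: sinks, and unreached elements that are not light.
    Right after a refill the latter are heavy. *)
Definition roots p Lt := Z :|: [set v in N | (p v == big) && (v \notin Lt)].

(** Read forward along the exchange graph, with the elements of [S] left implicit: from a light [x]
    through a recorded neighbour [u] to some [y] that may replace [u] in M1, ending at a root. *)
Fixpoint chain I p G Lt (l : seq V) : Prop :=
  match l with
  | [::] => False
  | x :: l' => x \notin S /\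
    match l' with
    | [::] => x \in roots p Lt
    | y :: _ => x \in Lt /\ (exists2 u, u \in G x & y \notin span I.1 (S :\ u)) /\
                chain I p G Lt l'
    end
  end.

(** [X] is the set of elements outside [S] met by the backward search and [D] that of the elements
    of [S] met. Since [D] avoids the reached set, [pa_done] says that a processed element has no
    reached M1-neighbour. *)
Record pass_ok I p G Lt (todo : seq (V * seq V)) (X D : {set V}) : Prop := PassOk {
  pa_todo : forall e, e \in todo -> e.1 \in X /\ chain I p G Lt (e.1 :: e.2);
  pa_roots : roots p Lt \subset X;
  pa_out : X \subset ~: S;
  pa_light : forall w, w \in Lt -> p w = big -> ~~ [disjoint G w & D] -> w \in X;
  pa_done : forall v, v \in X -> v \notin map fst todo -> v \in span I.1 D;
  pa_D : D \subset S :\: reached p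
}.

(** The exhausted search is a dual certificate: [D] spans [D :|: X] in M1 and [S :\: D] spans the
    rest in M2. An element outside [X] is either reached, with its support reached, or light, with
    its recorded neighbours outside [D]. *)
Lemma pass_optimal I p par t K G Lt X D : sinks_ok I -> search_ok I p par t ->
  lists_ok I p K G Lt -> pass_ok I p G Lt [::] X D ->
  forall T, common I T -> #|T| <= #|S|.
Proof.
move=> [cS zok] ok kok [_ rX XS lX dX DS] T cT; have [_ Si2] := cS.
have DS' : D \subset S := subset_trans DS (subsetDl _ _).
have cDS : #|D| + #|S :\: D| = #|S| by rewrite addnC -[in RHS](cardsID D) (setIidPr DS') addnC.
rewrite -cDS; apply: (card_common_le (A := D :|: X) (B := ~: (D :|: X)) cT).
- exact: setUCr.
- by rewrite subUset sub_span; apply/subsetP=> v vX; apply: dX.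
apply/subsetP=> v; rewrite inE in_setU negb_or => /andP[vD vX].
have [vS|vS] := boolP (v \in S); first by apply: mem_span; rewrite inE vD.
have vr : v \notin roots p Lt by apply: contraNN vX; apply: (subsetP rX).
have vZ : v \notin Z by apply: contraNN vr => vZ; rewrite inE vZ.
have v2 : v \in span I.2 S by move: (zok v vS); rewrite (negbTE vZ) => /esym/negbFE.
have RD : reached p \subset S :\: D.
  rewrite subsetD; apply/andP; split; first by apply/subsetP=> y; rewrite inE => /andP[].
  by move: DS; rewrite disjoint_sym subsetD => /andP[_].
rewrite (mem_span_supp Si2 v2) ?subsetDl //.
have [vb|bv] := ltnP (p v) big.
  by apply: subset_trans RD; apply: search_supp cS ok vS vb.
have pv : p v = big.
  case/orP: (so_label ok v) => [vt|/eqP //].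
  by have := leq_trans vt (ltnW (search_time ok)); rewrite ltnNge bv.
have vN : v \in N by rewrite inN vS.
have vL : v \in Lt by move: vr; rewrite in_setU (negbTE vZ) /= inE vN pv eqxx /= negbK.
have [_ Gs sG] := lo_light kok vL; apply: subset_trans sG _.
rewrite subUset RD andbT subsetD (subset_trans Gs (supp_sub _ _ _)) /=.
by apply: contraR vX; apply: lX.
Qed.

(** Each element outside [S] is processed once, with one test and the final negative test of
    [explore]; each element of [S] enters [D] once, for [E] queries. *)
Lemma search_pass p par t K G Lt todo X D :
  strat (fun I => [/\ sinks_ok I, search_ok I p par t, lists_ok I p K G Lt &
                      pass_ok I p G Lt todo X D])
    (fun (r : option (seq V)) c I =>
      c <= 2 * (size todo + #|~: X|) + #|S :\: reached p :\: D| * E /\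
      match r with
      | Some l => chain I p G Lt l /\
          (exists x l', l = x :: l' /\ x \notin span I.1 (S :\: reached p))
      | None => forall T, common I T -> #|T| <= #|S|
      end).
Proof.
have [n] := ubnP (size todo + #|~: X|); elim: n todo X D => // n IHn todo X D ltn.
case: todo ltn => [|[v l] todo] ltn.
  by apply: (@strat_ret _ _ _ _ None) => I [] zok ok kok pok; split=> //; apply: pass_optimal zok ok kok pok.
have [vS|vS] := boolP (v \in S).
  apply: (strat_void None) => I [_ _ _ /pa_todo/(_ (v, l) (mem_head _ _))[_ []]].
  by rewrite /= vS.
pose R := reached p; pose U := S :\: R :\: D.
have US : U \subset S by rewrite !(subset_trans (subsetDl _ _)).
have leU : #|U| <= 2 ^ L by apply: leq_trans leS; apply: subset_leq_card.
apply: (strat_span (o := Oracle1) (X := S :\: R) (v := v)).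
- by move=> I [[[Si _] _] _ _ _]; apply: indep_sub Si; apply: subsetDl.
- by rewrite inE (negbTE vS) andbF.
- apply: strat_bind.
    apply: strat_conseq (explore Oracle1 vS leU) _ (fun F c I _ H => H).
    move=> I [[[[Si _] _] _ _ _] v1]; split=> //.
    by apply: mem_span_mono v1; apply: subsetDl.
  move=> F c; pose Y := [set w in Lt | (p w == big) && (w \notin X) && ~~ [disjoint G w & F]].
  have YX : Y \subset ~: X by apply/subsetP=> w; rewrite !inE => /and3P[_ /andP[_ ->]].
  pose todo' := todo ++ [seq (w, v :: l) | w <- enum Y].
  have st : size todo' = size todo + #|Y| by rewrite size_cat size_map -cardE.
  have cX : #|~: X| = #|~: (X :|: Y)| + #|Y|.
    by rewrite setCU -setDE -[LHS](cardsID Y) (setIidPr YX) addnC.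
  have mlt : size todo' + #|~: (X :|: Y)| < n.
    by rewrite /= in ltn; rewrite st; nlia.
  apply: strat_conseq (IHn todo' (X :|: Y) (D :|: F) mlt) _ _.
    move=> I [[[zok ok kok pok] v1] [/= eF lec]]; split=> //.
    have [[Si1 Si2] zok'] := zok.
    have [ptodo proots pout plight pdone pD] := pok.
    have [vX cv] := ptodo (v, l) (mem_head _ _).
    have v1S : v \in span I.1 S by apply: mem_span_mono v1; apply: subsetDl.
    have YS : Y \subset ~: S.
      apply/subsetP=> w; rewrite !inE => /andP[wL _].
      by have [] := lo_light kok wL; rewrite inN => /andP[].
    split.
    + move=> e; rewrite mem_cat => /orP[et|].
        have [eX ce] : e.1 \in X /\ chain I p G Lt (e.1 :: e.2) by apply: ptodo; rewrite inE et orbT.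
        by split=> //; rewrite inE eX.
      case/mapP=> w; rewrite mem_enum => wY -> /=; split; first by rewrite inE wY orbT.
      split; first by have := subsetP YS w wY; rewrite inE.
      move: wY; rewrite inE => /and3P[wL _ /pred0Pn[u /andP[uG uF]]].
      split=> //; split=> //; exists u => //.
      by move: (uF : u \in F); rewrite eF !inE => /andP[/andP[]].
    + by apply: subset_trans proots (subsetUl _ _).
    + by rewrite subUset pout.
    + move=> w wL wb; rewrite disjoint_sym disjoints_subset subUset negb_and => dw.
      rewrite inE; have [//|wX /=] := boolP (w \in X).
      rewrite inE wL wb eqxx wX /=; case/orP: dw => [dD|dF].
        by case/negP: wX; apply: plight => //; rewrite disjoint_sym disjoints_subset.
      by rewrite disjoint_sym disjoints_subset.
    + move=> w; rewrite map_cat mem_cat negb_or => wXY /andP[wt wY].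
      have wY' : w \notin Y.
        apply: contraNN wY => wY; apply/mapP; exists (w, v :: l) => //.
        by apply/mapP; exists w; rewrite // mem_enum.
      move: wXY; rewrite inE (negbTE wY') orbF => wX.
      have [->|wv] := eqVneq w v; last first.
        by apply: mem_span_mono (subsetUl _ _) (pdone w wX _); rewrite /= inE negb_or wv.
      rewrite (mem_span_supp Si1 v1S); last first.
        rewrite subUset (subset_trans pD (subsetDl _ _)) eF.
        exact: subset_trans (subsetIl _ _) (supp_sub _ _ _).
      rewrite (mem_span_supp Si1 v1S) ?subsetDl // in v1.
      apply/subsetP=> u us; have := subsetP v1 u us.
      rewrite in_setU eF in_setI us [u \in U]in_setD /= => ->.
      by rewrite andbT; case: (u \in D).
    rewrite subUset pD eF; apply: subset_trans (subsetIr _ _) _; exact: subsetDl.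
  move=> r d I [[[zok ok kok pok] v1] [/= eF lec]] [led post]; split=> //.
  have FU : F \subset U by rewrite eF subsetIr.
  have e : S :\: R :\: (D :|: F) = U :\: F by rewrite -[LHS]setDDl.
  have cU : #|U| = #|U :\: F| + #|F| by rewrite -[LHS](cardsID F) (setIidPr FU) addnC.
  rewrite -/R e in led; rewrite -/R -/U cU mulnDl.
  by rewrite st in led; rewrite -/E in lec; nlia.
apply: (@strat_ret _ _ _ _ (Some (v :: l))) => I [[_ _ _ pok] v1]; split; first by rewrite /=; nlia.
split; last by exists v, l.
by have [] := pa_todo pok (mem_head _ _).
Qed.

Lemma light_marked I p par t K G Lt x : sinks_ok I -> search_ok I p par t ->
  lists_ok I p K G Lt -> x \in Lt -> x \notin S -> p x <> big -> G x \subset reached p.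
Proof.
move=> [cS zok] ok kok xL xS xb.
have [_ Gs _] := lo_light kok xL; apply: subset_trans Gs _.
apply: (search_supp cS ok xS).
by case/orP: (so_label ok x) => [xt|/eqP//]; apply: ltn_trans xt (search_time ok).
Qed.

Definition labels := ((V -> nat) * (V -> V) * nat)%type.

(* The path may meet an element that was reached while climbing; it is skipped,
   as all its neighbours are reached as well. *)
Lemma climb p0 K G Lt l p par t :
  strat (fun I => [/\ sinks_ok I, search_ok I p par t, lists_ok I p K G Lt,
        (forall w, w \in N -> settled p0 K Lt w) /\ chain I p0 G Lt l &
        [/\ (forall x, x \notin S -> x \notin Lt -> p x = p0 x), reached p0 \subset reached p &
        (exists x l', l = x :: l' /\ x \notin span I.1 (S :\: reached p))]])
    (fun (r : {set V} + labels) c I =>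
      match r with
      | inl S' => [/\ common I S', #|S'| = #|S|.+1 & c <= #|S|.+1 * E]
      | inr (p', par', t') => [/\ search_ok I p' par' t', reached p \subset reached p',
          #|reached p0| + h <= #|reached p'| &
          c + #|reached p| * E <= 1 + #|reached p'| * E]
      end).
Proof.
elim: l p par t => [|x l IHl] p par t.
  by apply: (strat_void (inl set0)) => I [_ _ _ []].
have [xS|xS] := boolP (x \in S).
  by apply: (strat_void (inl set0)) => I [_ _ _ [_ []]]; rewrite xS.
pose R := reached p.
have [xZ|xZ] := boolP (x \in Z).
  have [pxb|pxb] := eqVneq (p x) big; last first.
    apply: (strat_void (inl set0)) => I [[_ zok] ok _ _ _].
    have := zok x xS; rewrite xZ => /esym /negP; apply.
    have pxb' : p x < big.
      by case/orP: (so_label ok x) pxb => [xt _|-> //]; apply: ltn_trans xt (search_time ok).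
    exact: (mem_span_mono (lower_sub _ _ _) (so_lower ok xS pxb')).
  apply: strat_bind.
    apply: strat_conseq (augment (mark p x set0 t) par x leS) _ (fun S' c I _ H => H).
    move=> I [[cS zok] ok _ _ [_ _ [y [l' [[<- _] y1]]]]].
    by apply: (sink_ready cS ok xS pxb y1); rewrite -zok.
  move=> S' c; apply: (@strat_ret _ _ _ _ (inl S')) => I [_ [[h1 h2 _ _ _] le]].
  split=> //; rewrite addn0; apply: leq_trans le _; rewrite leq_mul2r; apply/orP; right.
  by rewrite ltnS; apply: subset_leq_card; apply/subsetP=> y; rewrite inE => /andP[].
have xN : x \in N by rewrite inN xS.
case: l IHl => [|y l] IHl.
  have [xr|xr] := boolP (x \in roots p0 Lt); last first.
    by apply: (strat_void (inl set0)) => I [_ _ _ [_ [_]]]; rewrite (negbTE xr).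
  have /andP[/eqP p0x xL] : (p0 x == big) && (x \notin Lt).
    by move: xr; rewrite in_setU (negbTE xZ) /= inE xN.
  have leU : #|S :\: R| <= 2 ^ L.
    by apply: leq_trans leS; apply: subset_leq_card; apply: subsetDl.
  have span_x I : sinks_ok I -> x \in span I.2 S.
    by case=> _ /(_ x xS); rewrite (negbTE xZ) => /esym/negbFE.
  apply: strat_bind.
    apply: strat_conseq (explore Oracle2 xS leU) _ (fun F c I _ H => H).
    by move=> I [zok _ _ _ _]; split; [case: zok => [[]]|apply: span_x|apply: subsetDl].
  move=> F c; apply: (@strat_ret _ _ _ _ (inr (mark p x F t, mark_par par x F, t.+1))).
  move=> I [[zok ok kok [st _] [p0p Rp [z [l' [[<- _] x1]]]]] [/= eF lec]].
  have pxb : p x = big by rewrite p0p.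
  have FR : F \subset S :\: R by rewrite eF subsetIr.
  have Fs : F \subset supp I.2 S x by rewrite eF subsetIl.
  have sF : supp I.2 S x \subset R :|: F.
    apply/subsetP=> u us; rewrite in_setU eF in_setI us in_setD (subsetP (supp_sub _ _ _) u us).
    by case: (u \in R).
  have rm := reached_mark ok xS FR.
  split.
  + by apply: (mark_ready _ ok xS pxb x1 _ FR Fs sF); [case: zok|apply: span_x].
  + by rewrite rm subsetUl.
  (* The gain is measured from [p0], the labels at the time of the backward search: the list of the
     heavy [x] had [h] unreached elements then, and all of them are reached now, whether during the
     climb or at its end. *)
  + have := st x xN; rewrite /settled (negbTE xL) /= => hK.
    apply: leq_trans (_ : #|reached p0 :|: (K x :\: reached p0)| <= _).
      rewrite cardsU (_ : _ :&: _ = set0) ?cards0 ?subn0 ?leq_add2l //.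
      by apply/setP=> u; rewrite !inE; case: (u \in S); case: (p0 u < big); rewrite ?andbF.
    apply: subset_leq_card; rewrite rm subUset (subset_trans Rp) ?subsetUl //=.
    apply: subset_trans (subsetDl _ _) _; apply: subset_trans sF.
    exact: (lo_supp kok xN).
  rewrite addn0 rm cardsU (_ : _ :&: _ = set0) ?cards0 ?subn0.
    by rewrite -/E in lec; rewrite mulnDl -/R; nlia.
  by apply/setP=> u; rewrite in_setI in_set0; apply/andP=> -[uR /(subsetP FR)]; rewrite inE uR.
have [xL|xL] := boolP (x \in Lt); last first.
  by apply: (strat_void (inl set0)) => I [_ _ _ [_ [_ []]]]; rewrite (negbTE xL).
pose F := G x :\: R.
pose st' := if p x == big then (mark p x F t, mark_par par x F, t.+1) else (p, par, t).
have key I : sinks_ok I -> search_ok I p par t -> lists_ok I p K G Lt ->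
  x \notin span I.1 (S :\: R) ->
  [/\ search_ok I st'.1.1 st'.1.2 st'.2, R \subset reached st'.1.1 &
      G x \subset reached st'.1.1 /\ forall z, z \notin S -> z \notin Lt -> st'.1.1 z = p z].
  move=> zok ok kok x1; rewrite /st'; case: eqP => [pxb|pxb] /=; last first.
    by split=> //; split=> //; apply: (light_marked zok ok kok).
  have [_ Gs sG] := lo_light kok xL.
  have GS : G x \subset S := subset_trans Gs (supp_sub _ _ _).
  have FR : F \subset S :\: R by apply: setSD.
  have Fs : F \subset supp I.2 S x := subset_trans (subsetDl _ _) Gs.
  have sF : supp I.2 S x \subset R :|: F.
    apply: subset_trans sG _; apply/subsetP=> u.
    by rewrite !in_setU in_setD => /orP[->|-> //]; rewrite andbT orbN.
  have rm := reached_mark ok xS FR.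
  have x2 : x \in span I.2 S.
    by case: zok => _ /(_ x xS); rewrite (negbTE xZ) => /esym/negbFE.
  split.
  + by apply: (mark_ready _ ok xS pxb x1 x2 FR Fs sF); case: zok.
  + by rewrite rm subsetUl.
  split; first by rewrite rm; apply/subsetP=> u uG; rewrite !in_setU in_setD uG andbT orbN.
  move=> z zS zL; rewrite /mark; case: eqP => [e|_] /=; first by rewrite e xL in zL.
  by case: ifP => // /(subsetP FR); rewrite inE (negbTE zS) andbF.
case: (st') key => [[p1 par1] t1] /= key.
apply: strat_conseq (IHl p1 par1 t1) _ _.
  move=> I [zok ok kok [sett [_ [_ [[u uG y1] ch]]]] [p0p Rp [z [l' [[<- _] x1]]]]].
  have [ok1 RR [GR same]] := key I zok ok kok x1; split=> //.
    exact: lists_ok_mono RR kok.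
  split.
  - by move=> w wS wL; rewrite same // p0p.
  - exact: subset_trans RR.
  exists y, l; split=> //; apply: contraNN y1; apply: mem_span_mono.
  by apply: setDS; rewrite sub1set; apply: (subsetP GR).
move=> r c I [zok ok kok _ [_ _ [z [l' [[<- _] x1]]]]].
have [_ RR _] := key I zok ok kok x1.
case: r => [S' //|[[p2 par2] t2] [r1 r2 r3 r4]]; split=> //.
  exact: subset_trans r2.
apply: leq_trans r4; rewrite leq_add2l leq_mul2r; apply/orP; right.
exact: subset_leq_card RR.
Qed.

Let nV := #|V|.
Let pass_cost := 2 * nV + #|S| * E + 1.

(** Separate budgets: the two refill potentials, one [pass_cost] per [h] newly reached elements, [E]
    per element reached while climbing, and the final augmentation. The 1 in [pass_cost] is the
    additive query of a climb. *)
Lemma search_loop p par t K G Lt :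
  strat (fun I => [/\ sinks_ok I, search_ok I p par t & lists_ok I p K G Lt])
    (fun (r : option {set V}) c I =>
      c + E * list_weight K + B0 * #|Lt| <=
        E * (#|S| * tau) + B0 * nV + (#|S :\: reached p| %/ h).+1 * pass_cost +
        #|S :\: reached p| * E + #|S|.+1 * E /\
      match r with
      | Some S' => common I S' /\ #|S'| = #|S|.+1
      | None => forall T, common I T -> #|T| <= #|S|
      end).
Proof.
have [n] := ubnP #|S :\: reached p|; elim: n p par t K G Lt => // n IHn p par t K G Lt ltn.
apply: strat_bind.
  apply: strat_conseq (refill p K G Lt) _ (fun r c I _ H => H).
  by move=> I [zok _ kok].
move=> [[K1 G1] Lt1] c1 /=.
pose X := roots p Lt1; pose todo := [seq (v, [::] : seq V) | v <- enum X].
have XS : X \subset ~: S.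
  rewrite subUset ZS; apply/subsetP=> v; rewrite inE inN => /andP[/andP[vS _] _].
  by rewrite inE.
apply: strat_bind.
  apply: strat_conseq (search_pass p par t K1 G1 Lt1 todo X set0) _ (fun r c I _ H => H).
  move=> I [[zok ok kok] [kok1 _ _]]; split=> //; split=> //.
  - move=> e /mapP[v]; rewrite mem_enum => vX -> /=; split=> //; split=> //.
    by have := subsetP XS v vX; rewrite inE.
  - by move=> w _ _; rewrite disjoint_sym disjoints_subset sub0set.
  - move=> v vX; case/negP; apply/mapP; exists (v, [::]) => //.
    by apply/mapP; exists v; rewrite ?mem_enum.
  - exact: sub0set.
have st : size todo + #|~: X| = nV by rewrite size_map -cardE cardsC.
have leR : #|S :\: reached p :\: set0| <= #|S|.
  by apply: subset_leq_card; rewrite setD0 subsetDl.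
have leRE := leq_mul leR (leqnn E).
have leL (A : {set V}) : B0 * #|A| <= B0 * nV by rewrite leq_mul2l (max_card (mem A)) orbT.
have pE : 2 * nV + #|S| * E + 1 = pass_cost by [].
move=> [l|] c2; last first.
  apply: (@strat_ret _ _ _ _ None) => I [[[zok ok kok] [kok1 _ le1]] [le2 opt]]; split=> //.
  have leW := leq_mul (leqnn E) (list_weight_le kok1); have leLt := leL Lt1.
  by rewrite st in le2; rewrite mulSn; rewrite /= in le1; plia.
apply: strat_bind.
  apply: strat_conseq (climb p K1 G1 Lt1 l p par t) _ (fun r c I _ H => H).
  by move=> I [[[zok ok kok] [kok1 sett _]] [_ [ch hit]]]; split.
move=> [S'|[[p1 par1] t1]] c3.
  apply: (@strat_ret _ _ _ _ (Some S')) => I [[[[zok ok kok] [kok1 _ le1]] [le2 _]] [h1 h2 le3]].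
  split=> //; have leW := leq_mul (leqnn E) (list_weight_le kok1); have leLt := leL Lt1.
  by rewrite st in le2; rewrite mulSn; rewrite /= in le1; plia.
have split_R q : #|S| = #|reached q| + #|S :\: reached q|.
  rewrite -[LHS](cardsID (reached q) S) (setIidPr _) //; apply/subsetP=> u.
  by rewrite inE => /andP[].
have [gain|gain] := leqP (#|reached p| + h) #|reached p1|; last first.
  by apply: (strat_void None) => I [_ [_ _ g _]].
have e0 := split_R p; have e1 := split_R p1.
have lt1 : #|S :\: reached p1| < n by nlia.
apply: strat_conseq (IHn p1 par1 t1 K1 G1 Lt1 lt1) _ _.
  move=> I [[[[zok ok kok] [kok1 _ _]] _] [ok1 RR _ _]]; split=> //.
  exact: lists_ok_mono RR kok1.
move=> r c4 I [[[[zok ok kok] [kok1 _ le1]] [le2 _]] [_ _ _ le3]] [le4 post]; split=> //.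
(* A gain of at least [h] lowers the quotient by one, which pays for the current pass. *)
have dv : (#|S :\: reached p1| %/ h).+1 <= #|S :\: reached p| %/ h.
  have hS : h <= #|S :\: reached p| by nlia.
  rewrite -[in leqRHS](subnK hS) divnDr ?dvdnn // divnn h_gt0 addn1 ltnS.
  by apply: leq_div2r; nlia.
have dv' := leq_mul dv (leqnn pass_cost).
have eR : #|S :\: reached p| * E + #|reached p| * E = #|S :\: reached p1| * E + #|reached p1| * E.
  by rewrite -!mulnDl; congr (_ * _); nlia.
by rewrite st in le2; rewrite mulSn; rewrite /= in le1 le4; plia.
Qed.

End Reach.

(** * Augmenting to optimality by repeated reachability *)

Section Finish.
Variable V : finType.
Implicit Types (S X : {set V}) (I : inst V).

Lemma query_filter o X (s : seq V) :
  strat (fun I => X \in indep (mat I o))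
    (fun Z c I => Z = [set v in s | (v \notin X) && (v \notin span (mat I o) X)] /\
                  c <= size s).
Proof.
elim: s => [|v s IHs].
  by apply: (@strat_ret _ _ _ _ set0) => I _; split=> //; apply/setP=> v; rewrite !inE.
have [vX|vX] := boolP (v \in X).
  apply: strat_conseq IHs _ _ => // Z c I _ [-> le]; split; last exact: leqW.
  by apply/setP=> w; rewrite !inE; case: eqP => [->|] //; rewrite vX /= andbF.
apply: (strat_span (o := o) (X := X) (v := v)) => //.
- apply: strat_conseq IHs _ _; first by move=> I [].
  move=> Z c I [_ vs] [-> le]; split; last by [].
  by apply/setP=> w; rewrite !inE; case: eqP => [->|] //; rewrite vs /= !andbF.
apply: strat_bind.
  by apply: strat_conseq IHs _ (fun r c I _ H => H); move=> I [].
move=> Z c; apply: (@strat_ret _ _ _ _ (v |: Z)) => I [[_ vs] [-> le]]; split; last by rewrite addn0.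
by apply/setP=> w; rewrite !inE; case: eqP => [->|] //=; rewrite vX.
Qed.

Definition bounded m I := forall T, common I T -> #|T| <= m.

(** The bound of [search_loop] with nothing reached and [m] in place of |S|, so that one figure
    serves every augmentation, plus |V| queries to find the sinks. *)
Definition reach_cost m L h tau :=
  #|V| + (L.+1 * (m * tau) + (2 + ((#|V| * h) %/ tau) * L.+1) * #|V| +
  (m %/ h).+1 * (2 * #|V| + m * L.+1 + 1) + m * L.+1 + m.+1 * L.+1).

Lemma improve S m L h tau : #|S| <= m -> m <= 2 ^ L -> 0 < h -> 0 < tau ->
  strat (fun I => common I S)
    (fun (r : option {set V}) c I => c <= reach_cost m L h tau /\
      match r with
      | Some S' => common I S' /\ #|S'| = #|S|.+1
      | None => forall T, common I T -> #|T| <= #|S|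
      end).
Proof.
move=> Sm mL h0 tau0.
apply: strat_bind.
  by apply: strat_conseq (query_filter Oracle2 S (enum V)) _ (fun r c I _ H => H) => I [].
move=> Z c; have [ZS|ZS] := boolP (Z \subset ~: S); last first.
  apply: (strat_void None) => I [_ [eZ _]]; case/negP: ZS; rewrite eZ.
  by apply/subsetP=> v; rewrite !inE => /and3P[].
have leS := leq_trans Sm mL.
apply: strat_conseq (search_loop leS h0 tau0 ZS (fun _ => #|V|.+1) id 0
  (fun _ => set0) (fun _ => set0) set0) _ _.
  move=> I [cS [eZ _]]; split.
  - split=> // v vS; rewrite eZ inE mem_enum vS //.
  - split=> //.
    + by move=> x; rewrite eqxx orbT.
    + by move=> v _; rewrite ltnn.
    + by move=> v _; rewrite ltnn.
    + by move=> v _; rewrite ltnn.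
  split=> //.
  - by move=> v _; apply: sub0set.
  - by move=> v; rewrite inE.
  - by move=> v; rewrite set0D cards0.
  by move=> u; rewrite (_ : [set _ | _] = set0) ?cards0 //; apply/setP=> v; rewrite !inE.
move=> r d I [cS [_ le1]] [le2 post]; split=> //.
rewrite -cardE in le1; apply: leq_add => //.
have eR : S :\: reached S (fun _ : V => #|V|.+1) = S.
  by apply/setP=> v; rewrite !inE ltnn andbF.
move: le2; rewrite eR => le2.
apply: leq_trans (leq_trans (leq_addr _ _) (leq_trans (leq_addr _ _) le2)) _.
have a1 : L.+1 * (#|S| * tau) <= L.+1 * (m * tau) by rewrite leq_mul2l leq_mul2r Sm !orbT.
have a2 : #|S| * L.+1 <= m * L.+1 by rewrite leq_mul2r Sm orbT.
have a3 : #|S|.+1 * L.+1 <= m.+1 * L.+1 by rewrite leq_mul2r ltnS Sm orbT.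
have a4 : (#|S| %/ h).+1 * (2 * #|V| + #|S| * L.+1 + 1) <= (m %/ h).+1 * (2 * #|V| + m * L.+1 + 1).
  by apply: leq_mul; [rewrite ltnS leq_div2r | rewrite leq_add2r leq_add2l].
by plia.
Qed.

Lemma finish S m L h tau : m <= 2 ^ L -> 0 < h -> 0 < tau ->
  strat (fun I => common I S /\ bounded m I)
    (fun S' c I => [/\ common I S', bounded #|S'| I, #|S| <= #|S'| &
       c <= (#|S'| - #|S|).+1 * reach_cost m L h tau]).
Proof.
move=> mL h0 tau0; have [n] := ubnP (m - #|S|); elim: n S => // n IHn S ltn.
have [Sm|Sm] := leqP #|S| m; last first.
  by apply: (strat_void set0) => I [cS /(_ S cS)]; rewrite leqNgt Sm.
apply: strat_bind.
  by apply: strat_conseq (improve Sm mL h0 tau0) _ (fun r c I _ H => H) => I [].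
move=> [S'|] c; last first.
  apply: (@strat_ret _ _ _ _ S) => I [[cS _] [le opt]]; split=> //.
  by rewrite addn0 subnn mul1n.
have [cS'|cS'] := eqVneq #|S'| #|S|.+1; last first.
  by apply: (strat_void set0) => I [_ [_ [_ /eqP]]]; rewrite (negbTE cS').
have [Sm'|Sm'] := leqP #|S'| m; last first.
  by apply: (strat_void set0) => I [[_ b] [_ [/b]]]; rewrite leqNgt Sm'.
have {}cS' : #|S'| = #|S|.+1 := cS'.
apply: strat_conseq (IHn S' _) _ _; first by nlia.
  by move=> I [[_ b] [_ []]].
move=> T d I [[_ b] [le _]] [h1 h2 h3 h4]; split=> //; first by nlia.
have -> : #|T| - #|S| = (#|T| - #|S'|).+1 by nlia.
by rewrite mulSn leq_add.
Qed.

End Finish.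

(** * Layered search *)

Section Layers.
Variables (V : finType) (L : nat).
Implicit Types (S U : {set V}) (p : V -> nat) (I : inst V) (par : V -> V).

Let E := L.+1.
Let nV := #|V|.

(** Label [lam] is exempt from [va_lower], so every sink has label exactly [lam]. *)
Record valid I S p lam : Prop := Valid {
  va_common : common I S;
  va_le : forall x, p x <= lam;
  va_upper : forall v, v \notin S -> 0 < p v -> v \in span I.1 (upper S p (p v).-1);
  va_lower : forall v, v \notin S -> p v < lam -> v \in span I.2 (lower S p (p v))
}.

(* [U] is the set of elements whose label may still be below their distance;
   elements leave [U] in order of label, those outside [S] first. *)
Record scan_ok I S p lam par U : Prop := ScanOk {
  sc_valid : valid I S p lam;
  sc_upper : forall v, v \notin S -> v \notin U -> p v < lam ->
    v \notin span I.1 (upper S p (p v));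
  sc_par : forall u, u \in S -> u \notin U -> p u < lam ->
    [/\ par u \notin S :|: U, p (par u) = p u & par u \notin span I.2 (S :\ u)];
  sc_lower : forall v, v \notin S -> v \notin U -> p v < lam ->
    v \in span I.2 (lower S p (p v) :\: U);
  sc_ord : forall x y, x \notin U -> y \in U -> p x <= p y
}.

Definition raise p x y := if y == x then (p x).+1 else p y.

Definition label_sum p := \sum_(x : V) p x.

Lemma label_sum_raise p x : label_sum (raise p x) = (label_sum p).+1.
Proof.
rewrite /label_sum (bigD1 x) //= [in RHS](bigD1 x) //= /raise eqxx.
by rewrite (eq_bigr p) // => y /negbTE->.
Qed.

Lemma raise_neq p x y : y != x -> raise p x y = p y.
Proof. by rewrite /raise => /negbTE->. Qed.

Lemma raise_leq p x y : p y <= raise p x y.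
Proof. by rewrite /raise; case: eqP => [->|]. Qed.

Lemma upper_raise_out S p x i : x \notin S -> upper S (raise p x) i = upper S p i.
Proof.
move=> xS; apply/setP=> y; rewrite !inE; case: (boolP (y \in S)) => //= yS.
by rewrite raise_neq //; apply: contraNneq xS => <-.
Qed.

Lemma lower_raise_out S p x i : x \notin S -> lower S (raise p x) i = lower S p i.
Proof.
move=> xS; apply/setP=> y; rewrite !inE; case: (boolP (y \in S)) => //= yS.
by rewrite raise_neq //; apply: contraNneq xS => <-.
Qed.

Lemma scan_raise_out I S p lam par U v : v \notin S -> v \in U -> p v < lam ->
  v \in span I.1 (upper S p (p v)) ->
  scan_ok I S p lam par U -> scan_ok I S (raise p v) lam par U.
Proof.
move=> vS vU vlam v1 [[cS ple v_up v_lo] s_up s_par s_lo s_ord].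
have nev w : w \notin U -> w != v by apply: contraNneq => ->.
split; [split|..] => //.
- by move=> x; rewrite /raise; case: eqP.
- move=> w wS; rewrite upper_raise_out //; rewrite /raise; case: eqP => [->|_] //.
  exact: v_up.
- move=> w wS; rewrite lower_raise_out //; rewrite /raise; case: eqP => [-> h|_] //.
    by apply: mem_span_mono (v_lo v vS _); rewrite ?lower_mono // ltnW.
  exact: v_lo.
- by move=> w wS wU; rewrite upper_raise_out // raise_neq ?nev //; apply: s_up.
- move=> u uS uU; rewrite raise_neq ?nev // => ul; have [h1 h2 h3] := s_par u uS uU ul.
  split=> //; rewrite raise_neq // nev //.
  by apply: contraNN h1 => h; rewrite inE h orbT.
- by move=> w wS wU; rewrite lower_raise_out // raise_neq ?nev //; apply: s_lo.
move=> x y xU yU; rewrite raise_neq ?nev //; apply: leq_trans (s_ord x y xU yU) _.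
exact: raise_leq.
Qed.

(** No element outside [S] of the same label remains in [U], and by [sc_lower] the settled ones are
    spanned in M2 without [U]; raising [u] therefore takes nothing from a lower span that is
    needed. *)
Lemma scan_raise_in I S p lam par U u : u \in S -> u \in U -> p u < lam ->
  (forall y, y \in U -> p u <= p y) -> (forall v, v \in U -> v \notin S -> p v <> p u) ->
  scan_ok I S p lam par U -> scan_ok I S (raise p u) lam par U.
Proof.
move=> uS uU ulam umin noV [[cS ple v_up v_lo] s_up s_par s_lo s_ord].
have neu w : w \notin U -> w != u by apply: contraNneq => ->.
have neS w : w \notin S -> w != u by apply: contraNneq => ->.
have up_mono i : upper S p i \subset upper S (raise p u) i.
  by apply/subsetP=> y; rewrite !inE => /andP[-> h]; apply: leq_trans h (raise_leq _ _ _).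
have lowU i : lower S (raise p u) i :\: U = lower S p i :\: U.
  apply/setP=> y; rewrite !inE; case: (boolP (y \in U)) => //= yU.
  by rewrite raise_neq ?neu.
split; [split|..] => //.
- by move=> x; rewrite /raise; case: eqP.
- move=> w wS; rewrite raise_neq ?neS // => w0.
  exact: mem_span_mono (up_mono _) (v_up w wS w0).
- move=> w wS; rewrite raise_neq ?neS // => wl.
  have [e|ne] := eqVneq (p w) (p u).
    have wU : w \notin U by apply/negP => wU; apply: noV wU wS e.
    by apply: mem_span_mono (s_lo w wS wU wl); rewrite -lowU subsetDl.
  apply: mem_span_mono (v_lo w wS wl); apply/subsetP=> y; rewrite !inE => /andP[-> yw] /=.
  rewrite /raise; case: eqP => // e; rewrite e in yw; rewrite ltn_neqAle eq_sym ne.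
  exact: yw.
- move=> w wS wU; rewrite raise_neq ?neS // => wl.
  apply: contraNN (s_up w wS wU wl); apply: mem_span_mono.
  apply/subsetP=> y; rewrite !inE => /andP[-> yw] /=; move: yw; rewrite /raise.
  by case: eqP => // -> _; apply: s_ord.
- move=> y yS yU; rewrite raise_neq ?neu // => yl; have [h1 h2 h3] := s_par y yS yU yl.
  split=> //; rewrite raise_neq // neS //.
  by apply: contraNN h1 => h; rewrite inE h.
- by move=> w wS wU; rewrite lowU raise_neq ?neu //; apply: s_lo.
move=> x y xU yU; rewrite raise_neq ?neu //; apply: leq_trans (s_ord x y xU yU) _.
exact: raise_leq.
Qed.

(** Once [v] cannot be raised, its neighbours of the same label still in [U] receive [v] as parent
    and leave [U] with it. By minimality of [p v] they are its only neighbours in [U] with label at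
    most [p v], so [v] stays spanned without the remaining [U]. *)
Lemma scan_settle I S p lam par U v (F : {set V}) : v \notin S -> v \in U -> p v < lam ->
  (forall y, y \in U -> p v <= p y) ->
  v \notin span I.1 (upper S p (p v)) ->
  F = supp I.2 S v :&: [set u in S :&: U | p u == p v] ->
  scan_ok I S p lam par U ->
  scan_ok I S p lam (fun u => if u \in F then v else par u) (U :\: (v |: F)).
Proof.
move=> vS vU vlam vmin v1 eF [[cS ple v_up v_lo] s_up s_par s_lo s_ord].
have [_ Si2] := cS.
have FE u : u \in F -> [/\ u \in S, p u = p v & v \notin span I.2 (S :\ u)].
  by rewrite eF !inE => /andP[/andP[uS h] /andP[_ /eqP pu]].
have outU' x : x \notin U :\: (v |: F) -> [\/ x \notin U, x = v | x \in F].
  rewrite in_setD in_setU1; case: (x =P v) => [->|_]; first by constructor 2.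
  by case: (boolP (x \in F)) => [xF|_ /= xU]; [constructor 3|constructor 1].
have UU : U :\: (v |: F) \subset U := subsetDl _ _.
split=> //.
- by move=> w wS /outU'[wU||/FE[]]; [apply: s_up|move=> ->|rewrite (negbTE wS)].
- move=> u uS /outU'[uU|eu|uF] ul.
  + have [h1 h2 h3] := s_par u uS uU ul.
    have uF : u \notin F by apply: contraNN uU; rewrite eF !inE => /andP[_ /andP[/andP[]]].
    rewrite (negbTE uF); split=> //; apply: contraNN h1; rewrite !inE.
    by case/orP=> [->//|/andP[_ ->]]; rewrite orbT.
  + by rewrite eu (negbTE vS) in uS.
  rewrite uF; have [_ h2 h3] := FE u uF; split=> //.
  by rewrite !inE eqxx (negbTE vS).
- move=> w wS /outU'[wU wl|-> _|/FE[]]; last by rewrite (negbTE wS).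
    by apply: mem_span_mono (s_lo w wS wU wl); apply: setDS.
  have vlo := v_lo v vS vlam.
  have v2 : v \in span I.2 S := mem_span_mono (lower_sub _ _ _) vlo.
  rewrite (mem_span_supp Si2 v2) ?lower_sub // in vlo.
  rewrite (mem_span_supp Si2 v2) ?(subset_trans (subsetDl _ _)) ?lower_sub //.
  apply/subsetP=> u us; have := subsetP vlo u us; rewrite in_setD => ulo; rewrite ulo andbT.
  rewrite in_setD in_setU1 negb_and negbK; case: (boolP (u \in U)) => [uU|]; last by rewrite orbT.
  rewrite orbF eF in_setI us !inE uU andbT.
  move: ulo; rewrite inE => /andP[-> uv] /=.
  by rewrite eqn_leq uv vmin ?orbT.
move=> x y /outU'[xU|->|/FE[_ -> _]] yU; have := subsetP UU y yU; [exact: s_ord|exact: vmin|exact: vmin].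
Qed.

(** A raise costs at most one query and is charged to [label_sum]; a settled element costs two
    queries outside [S] and [E] inside it, at most [E.+1] either way. *)
Lemma scan S p lam par U : #|S| <= 2 ^ L ->
  strat (fun I => scan_ok I S p lam par U)
    (fun (r : (V -> nat) * (V -> V) * {set V}) c I =>
      [/\ scan_ok I S r.1.1 lam r.1.2 r.2, (forall x, x \in r.2 -> r.1.1 x = lam) &
          c + label_sum p <= label_sum r.1.1 + #|U| * E.+1]).
Proof.
move=> leS; have [n] := ubnP (#|U| + (nV * lam - label_sum p)).
elim: n p par U => // n IHn p par U ltn.
have [U0|[x0 x0U]] := set_0Vmem U.
  apply: (@strat_ret _ _ _ _ (p, par, U)) => I ok; split=> //=; last by rewrite add0n leq_addr.
  by move=> x; rewrite U0 inE.
(* Doubling leaves room for a tie-break that puts elements outside [S] before those of [S] with the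
   same label. *)
pose key x := (p x).*2 + (x \in S).
have [x xU xmin] : exists2 x, x \in U & forall y, y \in U -> key x <= key y.
  by case: (arg_minnP key x0U) => x xU xmin; exists x.
have xmin' y : y \in U -> p x <= p y.
  by move=> /xmin; rewrite /key; case: (x \in S); case: (y \in S) => /=; nlia.
have [xl|lx] := ltnP (p x) lam; last first.
  apply: (@strat_ret _ _ _ _ (p, par, U)) => I ok; split=> //=; last by rewrite add0n leq_addr.
  move=> y yU; apply/eqP; rewrite eqn_leq (va_le (sc_valid ok)).
  exact: leq_trans lx (xmin' y yU).
(* The termination measure uses truncated subtraction and drops after a raise only if the label sum
   is below its maximum, which holds because [x] is below [lam]. *)
have [Plt|Pge] := ltnP (label_sum p) (nV * lam); last first.
  apply: (strat_void (p, par, U)) => I ok; move: Pge; rewrite leqNgt => /negP; apply.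
  rewrite /nV -sum_nat_const /label_sum (bigD1 x) //= [ltnRHS](bigD1 x) //= -addSn.
  by apply: leq_add => //; apply: leq_sum => y _; apply: va_le (sc_valid ok) _.
have [xS|xS] := boolP (x \in S).
  have noV v : v \in U -> v \notin S -> p v <> p x.
    by move=> /xmin; rewrite /key xS => h /negbTE e; rewrite e in h; nlia.
  apply: strat_conseq (IHn (raise p x) par U _) _ _.
  - by rewrite label_sum_raise; nlia.
  - by move=> I ok; apply: scan_raise_in.
  by move=> r c I ok [h1 h2]; rewrite label_sum_raise => h3; split=> //; nlia.
apply: (strat_span (o := Oracle1) (X := upper S p (p x)) (v := x)).
- by move=> I [[[Si _] _ _ _] _ _ _ _]; apply: indep_sub Si; apply: upper_sub.
- by apply: contraNN xS; apply: (subsetP (upper_sub _ _ _)).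
- apply: strat_conseq (IHn (raise p x) par U _) _ _.
  - by rewrite label_sum_raise; nlia.
  - by move=> I [ok x1]; apply: scan_raise_out.
  by move=> r c I [ok _] [h1 h2]; rewrite label_sum_raise => h3; split=> //; nlia.
pose W := [set u in S :&: U | p u == p x].
have WS : W \subset S by apply/subsetP=> u; rewrite !inE => /andP[/andP[]].
have leW : #|W| <= 2 ^ L by apply: leq_trans leS; apply: subset_leq_card.
apply: strat_bind.
  apply: strat_conseq (explore Oracle2 xS leW) _ (fun F c I _ H => H).
  move=> I [[[[_ Si2] _ _ v_lo] _ _ _ _] _]; split=> //.
  exact: mem_span_mono (lower_sub _ _ _) (v_lo x xS xl).
move=> F c; have [FU|FU] := boolP (F \subset S :&: U); last first.
  apply: (strat_void (p, par, U)) => I [_ [eF _]]; case/negP: FU; rewrite eF.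
  by apply: subset_trans (subsetIr _ _) _; apply/subsetP=> u; rewrite inE => /andP[].
have xF : x \notin F by apply: contraNN xS => /(subsetP FU); rewrite inE => /andP[].
have xFU : x |: F \subset U.
  by rewrite subUset sub1set xU; apply: subset_trans FU (subsetIr _ _).
have cU : #|U| = #|U :\: (x |: F)| + #|F|.+1.
  by rewrite -[LHS](cardsID (x |: F)) (setIidPr xFU) addnC cardsU1 xF.
apply: strat_conseq (IHn p (fun u => if u \in F then x else par u) (U :\: (x |: F)) _) _ _.
- by rewrite cU in ltn; nlia.
- by move=> I [[ok x1] [eF _]]; apply: scan_settle.
move=> r d I [_ [_ lec]] [h1 h2 h3]; split=> //.
rewrite cU mulnDl mulSn [#|F| * E.+1]mulnS; rewrite -/E /= in lec.
by plia.
Qed.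

Lemma valid_optimal I S p lam T : valid I S p lam -> common I T ->
  lam * #|T| <= lam * #|S| + #|S|.
Proof.
move=> [cS ple v_up v_lo] cT.
have := @level_bound _ I T S set0 p lam cT; rewrite cards0 addn0; apply => j jl; apply/subsetP=> v; rewrite inE => vj.
  have [vS|vS] := boolP (v \in S); first by apply: mem_span; rewrite inE vS ltnW.
  apply: mem_span_mono (v_up v vS _); last exact: leq_ltn_trans vj.
  by apply: upper_anti; rewrite -ltnS prednK // (leq_ltn_trans _ vj).
rewrite setU0; have [vS|vS] := boolP (v \in S); first by apply: mem_span; rewrite inE vS.
apply: mem_span_mono (v_lo v vS _); last exact: leq_ltn_trans jl.
exact: lower_mono.
Qed.

(** The span inclusions of [augmented] compose with those of [valid], so the labels are reused
    unchanged after an augmentation. *)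
Lemma valid_augmented I S p z S' : valid I S p (p z) -> augmented S p z S' I ->
  valid I S' p (p z).
Proof.
move=> [cS ple v_up v_lo] [cS' _ a_up a_lo _]; split=> // v _ hv.
- have [vS|vS] := boolP (v \in S); last exact: mem_span_sub (a_up _) (v_up v vS hv).
  by apply: (subsetP (a_up _)); rewrite inE vS leq_pred.
have [vS|vS] := boolP (v \in S); last exact: mem_span_sub (a_lo _ hv) (v_lo v vS hv).
by apply: (subsetP (a_lo _ hv)); rewrite inE vS leqnn.
Qed.

Definition state := ({set V} * (V -> nat) * nat)%type.

Lemma layer_step S p lam : #|S| <= 2 ^ L ->
  strat (fun I => valid I S p lam)
    (fun (r : state) c I =>
      [/\ valid I r.1.1 r.1.2 r.2,
          (#|r.1.1| = #|S|.+1 /\ r.2 = lam) \/ (r.1.1 = S /\ r.2 = lam.+1) &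
          c + label_sum p <= label_sum r.1.2 + (nV * E.+1 + (nV + nV) + #|S|.+1 * E)]).
Proof.
move=> leS; apply: strat_bind.
  apply: strat_conseq (scan p lam id [set: V] leS) _ (fun r c I _ H => H).
  by move=> I va; split=> // x; rewrite inE.
rewrite cardsT => -[[p1 par1] U1] c1 /=.
pose cand := [set v in ~: S | p1 v == lam].
apply: strat_bind.
  apply: strat_conseq (query_filter Oracle2 S (enum cand)) _ (fun r c I _ H => H).
  by move=> I [[[]]].
move=> Zs c2; apply: strat_bind.
  apply: strat_conseq (query_filter Oracle1 (upper S p1 lam) (enum Zs)) _ (fun r c I _ H => H).
  by move=> I [[[[[Si _] _ _ _]] _] _]; apply: indep_sub Si; apply: upper_sub.
have leA (A : {set V}) : size (enum A) <= nV by rewrite -cardE max_card.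
move=> Zr c3; have [Zr0|[z zr]] := set_0Vmem Zr.
  (* No sink of label [lam] escapes the M1-span of the upper set at [lam], so the sinks may move to
     the next level; the other elements of label [lam] are spanned in M2 by [S], the lower set at
     [lam]. *)
  pose p2 v := if v \in Zs then lam.+1 else p1 v.
  apply: (@strat_ret _ _ _ _ (S, p2, lam.+1)) => I [[[_ [ok out le1]] [eZ le2]] [eZr le3]].
  have ZE v : v \in Zs -> [/\ v \notin S, p1 v = lam & v \notin span I.2 S].
    by rewrite eZ inE mem_enum !inE => /andP[/andP[h1 /eqP h2] /andP[_ h3]].
  have [[cS ple v_up v_lo] _ _ _ _] := ok.
  have p2S v : v \in S -> p2 v = p1 v.
    by move=> vS; rewrite /p2; case: ifP => // /ZE[]; rewrite vS.
  have uE i : upper S p2 i = upper S p1 i.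
    by apply/setP=> v; rewrite !inE; case: (boolP (v \in S)) => //= /p2S->.
  have lE i : lower S p2 i = lower S p1 i.
    by apply/setP=> v; rewrite !inE; case: (boolP (v \in S)) => //= /p2S->.
  split=> /=; [split=> //| by right |].
  - by move=> v; rewrite /p2; case: ifP => // _; apply: leqW.
  - move=> v vS; rewrite uE /p2; case: ifP => [vZ _|_]; last exact: v_up.
    have : v \notin Zr by rewrite Zr0 inE.
    rewrite eZr inE mem_enum vZ /= negb_and !negbK => /orP[|//].
    by move/(subsetP (upper_sub _ _ _)); rewrite (negbTE vS).
  - move=> v vS; rewrite lE /p2; case: ifP => [_|vZ]; first by rewrite ltnn.
    rewrite ltnS leq_eqVlt => /orP[/eqP e|]; last exact: v_lo.
    rewrite e; have -> : lower S p1 lam = S.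
      by apply/setP=> y; rewrite !inE ple andbT.
    by apply: contraFT vZ => v2; rewrite eZ inE mem_enum !inE vS e eqxx.
  have le4 : label_sum p1 <= label_sum p2.
    by apply: leq_sum => v _; rewrite /p2; case: ifP => // /ZE[_ -> _].
  have l2 := leA cand; have l3 := leA Zs.
  by rewrite -/nV in le1; plia.
have [zS|zS] := boolP ((z \notin S) && (p1 z == lam)); last first.
  apply: (strat_void (S, p, lam)) => I [[_ [eZ _]] [eZr _]]; case/negP: zS.
  by move: zr; rewrite eZr inE mem_enum eZ inE mem_enum !inE => /andP[/andP[->]].
have /andP[zS' /eqP pz] := zS.
apply: strat_bind.
  apply: strat_conseq (augment p1 par1 z leS) _ (fun r c I _ H => H).
  move=> I [[[_ [[[cS ple v_up v_lo] s_up s_par s_lo _] out _]] [eZ _]] [eZr _]].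
  have notU v : p1 v < lam -> v \notin U1.
    by apply: contraTN => /out->; rewrite ltnn.
  split=> //; rewrite ?pz.
  - exact: v_lo.
  - move=> v vS [vl|->]; first by apply: s_up; rewrite ?notU.
    by rewrite pz; move: zr; rewrite eZr inE => /and3P[].
  - move=> u uS ul; have [h1 h2 h3] := s_par u uS (notU u ul) ul; split=> //.
    by apply: contraNN h1 => h; rewrite inE h.
  by move: zr; rewrite eZr inE mem_enum eZ inE => /andP[/and3P[]].
move=> S' c4; apply: (@strat_ret _ _ _ _ (S', p1, lam)).
move=> I [[[[_ [ok out le1]] [eZ le2]] [eZr le3]] [au le4]].
split=> /=; first by move: (sc_valid ok); rewrite -pz => va; apply: valid_augmented va au.
  by left; split=> //; apply: au_card au.
have l2 := leA cand; have l3 := leA Zs; rewrite -/nV in le1.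
have l4 : c4 <= #|S|.+1 * E.
  apply: leq_trans le4 _; rewrite leq_mul2r; apply/orP; right.
  by rewrite ltnS; apply: subset_leq_card; apply/subsetP=> y; rewrite inE => /andP[].
by plia.
Qed.

Definition layer_cost m := #|V| * L.+2 + (#|V| + #|V|) + m.+1 * L.+1.

(** Labels never decrease and stay at most [l], so all raises together cost at most |V| l; every
    other query is charged to an augmentation or to a new level. *)
Lemma layers S m l : m <= 2 ^ L ->
  strat (fun I => common I S /\ bounded m I)
    (fun S' c I => [/\ common I S',
       (forall T, common I T -> l * #|T| <= l * #|S'| + #|S'|), #|S| <= #|S'| &
       c <= #|V| * l + (l + (#|S'| - #|S|)) * layer_cost m]).
Proof.
move=> mL.
suff H p lam : strat (fun I => [/\ valid I S p lam, bounded m I & lam <= l])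
    (fun S' c I => [/\ common I S',
       (forall T, common I T -> l * #|T| <= l * #|S'| + #|S'|), #|S| <= #|S'| &
       c + label_sum p <= #|V| * l + ((l - lam) + (#|S'| - #|S|)) * layer_cost m]).
  apply: strat_conseq (H (fun _ => 0) 0) _ _; first by move=> I [].
  by move=> S' c I _ [h1 h2 h3]; rewrite /label_sum big1 // addn0 subn0 => h4; split.
have [n] := ubnP ((m - #|S|) + (l - lam)); elim: n S p lam => // n IHn S p lam ltn.
have [Sm|Sm] := leqP #|S| m; last first.
  by apply: (strat_void set0) => I [[cS _ _ _] /(_ S cS)]; rewrite leqNgt Sm.
have [laml|llam] := ltnP lam l; last first.
  apply: (@strat_ret _ _ _ _ S) => I [va _ ll].
  have el : lam = l by apply/eqP; rewrite eqn_leq ll.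
  rewrite el in va; split=> //; first by case: va.
    by move=> T cT; apply: valid_optimal va cT.
  rewrite el !subnn addn0 mul0n addn0 add0n -sum_nat_const.
  by apply: leq_sum => x _; apply: va_le va x.
apply: strat_bind.
  by apply: strat_conseq (layer_step p lam (leq_trans Sm mL)) _ (fun r c I _ H => H) => I [].
move=> [[S1 p1] lam1] c.
have [d1|d1] := boolP [|| (#|S1| == #|S|.+1) && (lam1 == lam) | (S1 == S) && (lam1 == lam.+1)];
    last first.
  apply: (strat_void set0) => I [_ [/= _ d _]]; case/negP: d1.
  by case: d => -[-> ->]; rewrite !eqxx // orbT.
have [Sm1|Sm1] := leqP #|S1| m; last first.
  by apply: (strat_void set0) => I [[_ b _] [[cS _ _ _] _ _]]; have := b S1 cS; rewrite leqNgt Sm1.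
have [g1 g2 g3] : [/\ #|S| <= #|S1|, lam1 <= l &
    ((l - lam) + (m - #|S|)) = ((l - lam1) + (m - #|S1|)).+1].
  by case/orP: d1 => /andP[/eqP e1 /eqP e2]; rewrite ?e1 ?e2; rewrite ?e1 in Sm1; split; nlia.
apply: strat_conseq (IHn S1 p1 lam1 _) _ _; first by nlia.
  by move=> I [[_ b _] [va _ _]].
move=> S2 d I [_ [_ _ le1]] [h1 h2 h3 h4]; split=> //; first exact: leq_trans h3.
have e : (l - lam) + (#|S2| - #|S|) = ((l - lam1) + (#|S2| - #|S1|)).+1 by nlia.
rewrite e mulSn.
have l5 : nV * E.+1 + (nV + nV) + #|S|.+1 * E <= layer_cost m.
  by rewrite leq_add2l leq_mul2r ltnS Sm orbT.
by rewrite /= in le1; move: (layer_cost m) l5 h4 => K l5 h4; plia.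
Qed.

End Layers.

(** * Auction *)

Section Auction.
Variables (V : finType) (L l : nat).
Implicit Types (S K Q : {set V}) (p : V -> nat) (I : inst V).

Let nV := #|V|.

(** [pr_cheap] strengthens independence in M2: an element of [S] stays independent of the rest of
    [S] even when all elements of smaller label are added. This is what yields the lower spans, see
    [round_drop]. *)
Record priced I S p : Prop := Priced {
  pr_indep : S \in indep I.1;
  pr_le : forall x, p x <= l;
  pr_lt : forall u, u \in S -> p u < l;
  pr_cheap : forall x, x \in S -> x \notin span I.2 ([set y | p y < p x] :|: S :\ x);
  pr_upper : forall v, v \notin S -> 0 < p v -> v \in span I.1 (upper S p (p v).-1)
}.

(* [Q] contains the elements that have not been offered in this round, [K] those
   pushed out of [S] during it. *)
Record round_ok I S p K Q : Prop := RoundOk {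
  ro_priced : priced I S p;
  ro_indep : S :|: K \in indep I.2;
  ro_out : Q \subset ~: (S :|: K);
  ro_le : forall u x, u \in K -> x \in Q -> p u <= p x;
  ro_done : forall x, x \notin Q -> p x < l -> x \in span I.2 (lower S p (p x) :|: K)
}.

(** The potential of the auction: pushing [u] out in favour of an element of label one larger raises
    it by exactly one, and it is at most |S| l because labels in [S] stay below [l]. *)
Definition value S p := \sum_(u in S) (p u).+1.

Lemma priced_common I S p : priced I S p -> common I S.
Proof.
move=> [Si1 _ _ cheap _]; split=> //; apply/indepP => x xS.
by apply: contraNN (cheap x xS); apply: mem_span_mono; apply: subsetUr.
Qed.

(** * The possible outcomes of offering one element *)

Section Step.
Variables (I : inst V) (S : {set V}) (p : V -> nat) (K Q : {set V}) (x : V).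
Hypothesis ok : round_ok I S p K Q.
Hypotheses (xQ : x \in Q) (xl : p x < l) (xmin : forall y, y \in Q -> p x <= p y).

Let xSK : x \notin S :|: K.
Proof. by have := subsetP (ro_out ok) x xQ; rewrite in_setC. Qed.

Let xS : x \notin S.
Proof. by apply: contraNN xSK; rewrite inE => ->. Qed.

(** If the M2-support of [x] contained some [y] in [S] with larger label, exchange would span [y] by
    the other elements of [S], [x] and [K], where [x] and [K] are all cheaper than [y], against
    [pr_cheap]. *)
Lemma round_drop : x \in span I.2 (S :|: K) -> round_ok I S p K (Q :\ x).
Proof.
case: (ok) => pr SK2 out KQ dn x2; split=> //.
- exact: subset_trans (subsetDl _ _) out.
- by move=> u y uK; rewrite inE => /andP[_]; apply: KQ.
move=> z; rewrite !inE negb_and negbK => /orP[/eqP-> _|]; last exact: dn.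
rewrite (mem_span_supp SK2 x2) ?setSU ?lower_sub //.
apply/subsetP=> y yx; have := yx; rewrite inE => /andP[ySK xy].
rewrite in_setU; have [//|yK] := boolP (y \in K); first by rewrite orbT.
have yS : y \in S by move: ySK; rewrite in_setU (negbTE yK) orbF.
rewrite orbF inE yS /= leqNgt; apply/negP => lt.
have /negP := pr_cheap pr yS; apply.
apply: mem_span_mono (span_swap x2 ySK xy); apply/subsetP=> w.
rewrite !inE => /predU1P[->|/andP[wy /orP[->|wK]]]; rewrite ?lt ?wy ?orbT //.
by rewrite (leq_ltn_trans (KQ w x wK xQ)).
Qed.

Lemma round_raise : x \in span I.1 (upper S p (p x)) -> round_ok I S (raise p x) K Q.
Proof.
case: (ok) => -[Si1 ple plt cheap p_up] SK2 out KQ dn x1.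
have neS y : y \in S -> y != x by apply: contraTneq => ->.
split=> //; [split=> //|..].
- by move=> y; rewrite /raise; case: eqP.
- by move=> u uS; rewrite raise_neq ?neS //; apply: plt.
- move=> y yS; rewrite raise_neq ?neS //; apply: contraNN (cheap y yS).
  apply: mem_span_mono; apply: setSU; apply/subsetP=> w; rewrite !inE.
  by apply: leq_trans; rewrite ltnS raise_leq.
- move=> v vS; rewrite upper_raise_out //; rewrite /raise; case: eqP => [->|_] //.
  exact: p_up.
- move=> u y uK yQ; rewrite raise_neq; first exact: leq_trans (KQ u y uK yQ) (raise_leq _ _ _).
  by apply: contraNneq xSK => <-; rewrite inE uK orbT.
move=> y yQ; rewrite lower_raise_out // raise_neq; first exact: dn.
by apply: contraNneq yQ => ->.
Qed.

Lemma low_span y : p y < p x -> y \in span I.2 (S :|: K).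
Proof.
move=> yx; have yQ : y \notin Q by apply: contraTN yx => /xmin; rewrite -leqNgt.
by apply: mem_span_mono (ro_done ok yQ (ltn_trans yx xl)); apply: setSU; apply: lower_sub.
Qed.

(** Everything cheaper than [x] has been processed and lies in the M2-span of [S :|: K], which
    misses [x]. For an old [y], either [x] already counts as cheaper, or exchange would put [x] in
    that span. *)
Lemma cheap_push S1 p1 : x \notin span I.2 (S :|: K) -> S1 \subset S ->
  (forall y, p y <= p1 y) -> (forall y, y \in x |: S1 -> p1 y = p y) ->
  forall y, y \in x |: S1 -> y \notin span I.2 ([set w | p1 w < p1 y] :|: (x |: S1) :\ y).
Proof.
move=> x2 S1S pp1 same y yS1; rewrite same //.
have cheap := pr_cheap (ro_priced ok).
have lowp i : i <= p x -> [set w | p w < i] \subset span I.2 (S :|: K).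
  by move=> ix; apply/subsetP=> w; rewrite inE => wi; apply: low_span; apply: leq_trans ix.
have sub : [set w | p1 w < p y] \subset [set w | p w < p y].
  by apply/subsetP=> w; rewrite !inE; apply: leq_ltn_trans.
move: yS1; rewrite in_setU1 => /predU1P[ex|yS1].
  rewrite ex; apply: contraNN x2; apply: mem_span_sub; rewrite subUset; apply/andP; split.
    by rewrite -ex; apply: subset_trans sub _; rewrite ex; apply: lowp.
  apply: subset_trans (sub_span _ _); apply/subsetP=> w; rewrite !inE => /andP[/negbTE->] /=.
  by move=> /(subsetP S1S)->.
have yS := subsetP S1S y yS1; pose B := [set w | p w < p y] :|: S :\ y.
have sB : [set w | p1 w < p y] :|: (x |: S1) :\ y \subset x |: B.
  rewrite subUset; apply/andP; split.
    by apply: subset_trans sub _; apply: subset_trans (subsetUr _ _); apply: subsetUl.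
  apply/subsetP=> w; rewrite !inE => /andP[-> /predU1P[->|/(subsetP S1S)->]]; rewrite ?eqxx ?orbT //.
apply: contraNN (cheap y yS) => /(mem_span_mono sB) yB.
have [lt|le] := ltnP (p x) (p y).
  apply: mem_span_mono yB; rewrite subUset sub1set !inE lt /=; exact: subxx.
apply: contraNT x2 => yB'; apply: mem_span_sub (span_exchange yB yB').
rewrite subUset sub1set; apply/andP; split; first by apply: mem_span; rewrite inE yS.
rewrite subUset lowp //=; apply: subset_trans (sub_span _ _).
exact: subset_trans (subsetDl _ _) (subsetUl _ _).
Qed.

Lemma round_add : x \notin span I.2 (S :|: K) -> x \notin span I.1 S ->
  round_ok I (x |: S) p K (Q :\ x).
Proof.
case: (ok) => -[Si1 ple plt cheap p_up] SK2 out KQ dn x2 x1.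
have upS i : upper S p i \subset upper (x |: S) p i.
  by apply/subsetP=> y; rewrite !inE => /andP[-> ->]; rewrite orbT.
have loS i : lower S p i \subset lower (x |: S) p i.
  by apply/subsetP=> y; rewrite !inE => /andP[-> ->]; rewrite orbT.
split; [split=> //|..].
- exact: indep_setU1.
- by move=> u; rewrite in_setU1 => /predU1P[->|/plt].
- exact: cheap_push.
- move=> v; rewrite in_setU1 negb_or => /andP[_ vS] v0.
  exact: mem_span_mono (upS _) (p_up v vS v0).
- by rewrite -setUA; apply: indep_setU1.
- apply/subsetP=> y; rewrite !inE => /andP[/negbTE-> yQ] /=.
  by have := subsetP out y yQ; rewrite !inE.
- by move=> u y uK; rewrite inE => /andP[_]; apply: KQ.
move=> y; rewrite !inE negb_and negbK => /orP[/eqP-> _|yQ yl].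
  by apply: mem_span; rewrite !inE eqxx leqnn.
by apply: mem_span_mono (dn y yQ yl); apply: setSU.
Qed.

(** [pr_upper] confines the M1-support of [x] to labels at least [(p x).-1], so the removed [u] is
    exactly one level below. Raising [u] as it leaves keeps the upper spans, because [x] and the
    other upper elements span it. *)
Lemma round_kick u : x \notin span I.2 (S :|: K) -> x \in span I.1 S ->
  u \in supp I.1 S x -> p u < p x ->
  (p u).+1 = p x /\ round_ok I (x |: S :\ u) (raise p u) (u |: K) (Q :\ x).
Proof.
case: (ok) => -[Si1 ple plt cheap p_up] SK2 out KQ dn x2 x1 us ux.
have := us; rewrite inE => /andP[uS xu].
have x0 : 0 < p x by apply: leq_ltn_trans ux.
have xup := p_up x xS x0.
have pu : (p u).+1 = p x.
  have := xup; rewrite (mem_span_supp Si1 x1) ?upper_sub // => /subsetP/(_ u us).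
  by rewrite inE => /andP[_]; nlia.
split=> //; pose p1 := raise p u; pose S1 := x |: S :\ u.
have xu' : x != u by apply: contraNneq xS => ->.
have same y : y != u -> p1 y = p y by apply: raise_neq.
have upS i : upper S p i \subset span I.1 (upper S1 p1 i).
  have [iu|ui] := leqP i (p u); last first.
    apply: subset_trans (sub_span _ _); apply/subsetP=> y; rewrite !inE => /andP[yS iy].
    have yu : y != u by apply: contraTneq iy => ->; rewrite -ltnNge.
    by rewrite yu yS same // iy orbT.
  have sub : x |: upper S p i :\ u \subset upper S1 p1 i.
    apply/subsetP=> y; rewrite !inE => /predU1P[->|/and3P[yu -> iy]].
      by rewrite eqxx /= same // -pu leqW.
    by rewrite yu same // iy orbT.
  apply/subsetP=> y yi; have [->|yu] := eqVneq y u.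
    apply: mem_span_mono sub (span_swap _ _ _); rewrite ?inE ?uS //.
      by apply: mem_span_mono xup; apply: upper_anti; rewrite -pu.
    by apply: contraNN xu; apply: mem_span_mono; apply: setSD; apply: upper_sub.
  by apply: mem_span; apply: (subsetP sub); rewrite in_setU1 in_setD1 yu yi orbT.
have loS i : lower S p i :|: K \subset lower S1 p1 i :|: (u |: K).
  apply/subsetP=> y; rewrite !inE => /orP[/andP[yS yi]|->]; last by rewrite !orbT.
  by have [->|yu] := eqVneq y u; rewrite ?orbT // yS same // yi orbT.
split; [split=> //|..].
- apply: indep_setU1 => //; exact: indep_sub (subsetDl _ _) Si1.
- move=> y; rewrite /raise; case: eqP => // _; rewrite pu; exact: ple.
- move=> y; rewrite in_setU1 => /predU1P[->|]; first by rewrite raise_neq.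
  by rewrite in_setD1 => /andP[yu /plt]; rewrite raise_neq.
- apply: cheap_push => //; first exact: subsetDl.
    by move=> y; apply: raise_leq.
  move=> y; rewrite in_setU1 => /predU1P[->|]; first exact: same.
  by rewrite in_setD1 => /andP[yu _]; apply: same.
- move=> v vS1 v0; have [e|vu] := eqVneq v u.
    by apply: (subsetP (upS _)); rewrite e inE uS /raise eqxx leqnn.
  rewrite raise_neq // in v0 *; apply: mem_span_sub (upS _) (p_up v _ v0).
  by apply: contraNN vS1 => vS; rewrite !inE vu vS orbT.
- have -> : (x |: S :\ u) :|: (u |: K) = x |: (S :|: K).
    apply/setP=> y; rewrite !inE -!orbA; case: (y == x) => //=.
    by have [->|_] := eqVneq y u; rewrite /= ?uS.
  exact: indep_setU1.
- apply/subsetP=> y; rewrite !inE => /andP[/negbTE-> yQ] /=.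
  have := subsetP out y yQ; rewrite !inE !negb_or => /andP[yS yK].
  by rewrite (negbTE yS) andbF /= yK andbT; apply: contraNneq yS => ->.
- move=> w y; rewrite in_setU1 => hw; rewrite inE => /andP[_ yQ].
  have yu : y != u.
    by apply: contraTneq yQ => ->; apply/negP=> /(subsetP out); rewrite !inE uS.
  rewrite [raise p u y]raise_neq // /raise; case: eqP hw => [-> _|_ /= wK]; last exact: KQ.
  by rewrite pu xmin.
move=> y yQ yl; have [->|yu] := eqVneq y u; first by apply: mem_span; rewrite !inE eqxx orbT.
rewrite raise_neq // in yl *; have [->|yx] := eqVneq y x.
  by apply: mem_span; rewrite !inE eqxx raise_neq // leqnn.
have yQ' : y \notin Q by move: yQ; rewrite in_setD1 yx.
by apply: mem_span_mono (dn y yQ' yl); apply: loS.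
Qed.

End Step.

Lemma value_add S p x : x \notin S -> value (x |: S) p = (p x).+1 + value S p.
Proof. by move=> xS; rewrite /value big_setU1. Qed.

Lemma value_kick S p x u : u \in S -> x \notin S -> (p u).+1 = p x ->
  value (x |: S :\ u) (raise p u) = (value S p).+1.
Proof.
move=> uS xS pu; rewrite value_add ?inE ?negb_and ?xS ?orbT //.
have xu : x != u by apply: contraNneq xS => ->.
rewrite /value raise_neq // [in RHS](bigD1 u) //= -pu -addSn; congr (_ + _).
apply: eq_big => [y|y]; rewrite !inE; first by rewrite andbC.
by move=> /andP[yu _]; rewrite raise_neq.
Qed.

Lemma value_le I S p : priced I S p -> value S p <= #|S| * l.
Proof. by move=> pr; rewrite -sum_nat_const; apply: leq_sum => u /(pr_lt pr). Qed.

Definition round_state := ({set V} * (V -> nat) * {set V})%type.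

(** A raise costs two queries, charged to [2 * label_sum p]. Any other outcome removes [x] from [Q]
    for at most three queries, plus the [L] queries that find the element to push out, charged to
    [value]. Each addition to [K] also raises [value]. *)
Lemma auction_round m S p K Q : m <= 2 ^ L ->
  strat (fun I => round_ok I S p K Q /\ bounded m I)
    (fun (r : round_state) c I =>
      [/\ priced I r.1.1 r.1.2,
        (forall x, r.1.2 x < l -> x \in span I.2 (lower r.1.1 r.1.2 (r.1.2 x) :|: r.2)),
        #|r.2| + value S p <= #|K| + value r.1.1 r.1.2 &
        c + 2 * label_sum p + L * value S p <= 2 * label_sum r.1.2 + L * value r.1.1 r.1.2 + 3 * #|Q|]).
Proof.
move=> mL; have [n] := ubnP (#|Q| + (nV * l - label_sum p)).
elim: n S p K Q => // n IHn S p K Q ltn.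
have stop : (forall y, y \in Q -> l <= p y) ->
    strat (fun I => round_ok I S p K Q /\ bounded m I)
    (fun (r : round_state) c I =>
      [/\ priced I r.1.1 r.1.2,
        (forall x, r.1.2 x < l -> x \in span I.2 (lower r.1.1 r.1.2 (r.1.2 x) :|: r.2)),
        #|r.2| + value S p <= #|K| + value r.1.1 r.1.2 &
        c + 2 * label_sum p + L * value S p <= 2 * label_sum r.1.2 + L * value r.1.1 r.1.2 + 3 * #|Q|]).
  move=> Ql; apply: (@strat_ret _ _ _ _ (S, p, K)) => I [[pr _ _ _ dn] _]; split=> //=.
    by move=> x xl; apply: dn => //; apply: contraTN xl => /Ql; rewrite -leqNgt.
  by rewrite add0n leq_addr.
have [Q0|[x0 x0Q]] := set_0Vmem Q; first by apply: stop => y; rewrite Q0 inE.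
have [x xQ xmin] : exists2 x, x \in Q & forall y, y \in Q -> p x <= p y.
  by case: (arg_minnP p x0Q) => x xQ xmin; exists x.
have [xl|lx] := ltnP (p x) l; last by apply: stop => y /xmin; apply: leq_trans.
have [xSK|xSK] := boolP (x \in S :|: K).
  apply: (strat_void (S, p, K)) => I [[_ _ /subsetP/(_ x xQ)]].
  by rewrite in_setC xSK.
have xS : x \notin S by apply: contraNN xSK; rewrite inE => ->.
have [Plt|Pge] := ltnP (label_sum p) (nV * l); last first.
  apply: (strat_void (S, p, K)) => I [ok _]; move: Pge; rewrite leqNgt => /negP; apply.
  rewrite /nV -sum_nat_const /label_sum (bigD1 x) //= [ltnRHS](bigD1 x) //= -addSn.
  by apply: leq_add => //; apply: leq_sum => y _; apply: pr_le (ro_priced ok) _.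
have cQ : #|Q| = #|Q :\ x|.+1 by rewrite (cardsD1 x) xQ.
apply: (strat_span (o := Oracle2) (X := S :|: K) (v := x)) => //.
- by move=> I [[]].
- apply: strat_conseq (IHn S p K (Q :\ x) _) _ _; first by nlia.
    by move=> I [[ok b] x2]; split=> //; apply: round_drop.
  by move=> r c I _ [h1 h2 h3 h4]; split=> //; rewrite cQ mulnS; plia.
apply: (strat_span (o := Oracle1) (X := upper S p (p x)) (v := x)).
- by move=> I [[[[Si _ _ _ _]]]]; intros; apply: indep_sub Si; apply: upper_sub.
- by apply: contraNN xS; apply: (subsetP (upper_sub _ _ _)).
- apply: strat_conseq (IHn S (raise p x) K Q _) _ _; first by rewrite label_sum_raise; nlia.
    by move=> I [[[ok b] _] x1]; split=> //; apply: round_raise.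
  have -> : value S (raise p x) = value S p.
    apply: eq_bigr => u uS; rewrite raise_neq //; by apply: contraNneq xS => <-.
  by rewrite label_sum_raise mulnS => r c I _ [h1 h2 h3 h4]; split=> //; plia.
apply: (strat_span (o := Oracle1) (X := S) (v := x)) => //.
- by move=> I [[[[[Si _ _ _ _]]]]].
- have [Sm|Sm] := leqP #|S| m; last first.
    apply: (strat_void (S, p, K)) => I [[[[ok b] _] _] _].
    by have := b S (priced_common (ro_priced ok)); rewrite leqNgt Sm.
  pose U := [set u in S | p u < p x].
  have eU : S :\: U = upper S p (p x).
    by apply/setP=> y; rewrite !inE; case: (y \in S); rewrite //= ?andbT ?andbF -leqNgt.
  have leU : #|U| <= 2 ^ L.
    by apply: leq_trans (leq_trans Sm mL); apply/subset_leq_card/subsetP=> y; rewrite inE => /andP[].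
  apply: strat_bind.
    apply: strat_conseq (find_min Oracle1 (fun=> 0) xS leU) _ (fun u c I _ H => H).
    move=> I [[[[[[Si _ _ _ _] _ _ _ _] _] _] x1'] x1]; split=> //.
    by rewrite eU.
  move=> u c; have [uU|uU] := boolP (u \in U); last first.
    by apply: (strat_void (S, p, K)) => I [_ [_ H _ _]].
  have /andP[uS ux] : (u \in S) && (p u < p x) by move: uU; rewrite inE.
  have [pu|pu] := eqVneq (p u).+1 (p x); last first.
    apply: (strat_void (S, p, K)) => I [[[[[ok b] x2] x1'] x1] [_ _ us _]].
    by have [/eqP] := round_kick ok xQ xl xmin x2 x1 us ux; rewrite (negbTE pu).
  have eT := label_sum_raise p u; have eV := value_kick uS xS pu.
  apply: strat_conseq (IHn (x |: S :\ u) (raise p u) (u |: K) (Q :\ x) _) _ _.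
  + by rewrite eT; nlia.
  + move=> I [[[[[ok b] x2] x1'] x1] [_ _ us _]]; split=> //.
    by have [] := round_kick ok xQ xl xmin x2 x1 us ux.
  move=> r d I [_ [cL _ _ _]]; rewrite eT eV !mulnS cQ => -[h1 h2 h3 h4]; split=> //.
    by move: h3; rewrite cardsU1; case: (u \notin K) => /=; nlia.
  by rewrite mulnS; plia.
have eV := value_add p xS.
apply: strat_conseq (IHn (x |: S) p K (Q :\ x) _) _ _; first by nlia.
  by move=> I [[[[ok b] x2] _] x1]; split=> //; apply: round_add.
move=> r c I _; rewrite eV mulnDr cQ !mulnS => -[h1 h2 h3 h4]; split=> //; first by nlia.
by plia.
Qed.

(** A round that pushes out at least [kap] elements raises [value] by [kap], which bounds the number
    of rounds; otherwise [level_bound] applies with the small set [K1]. *)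
Lemma auction_run m kap S p : m <= 2 ^ L -> 0 < kap ->
  strat (fun I => priced I S p /\ bounded m I)
    (fun S' c I => [/\ common I S',
      (forall T, common I T -> l * #|T| <= l * (#|S'| + kap) + #|S'|) &
      c + 2 * label_sum p + L * value S p <=
        2 * (nV * l) + L * (m * l) + ((m * l - value S p) %/ kap).+1 * (3 * nV)]).
Proof.
move=> mL k0; have [n] := ubnP (m * l - value S p); elim: n S p => // n IHn S p ltn.
apply: strat_bind.
  apply: strat_conseq (auction_round S p set0 (~: S) mL) _ (fun r c I _ H => H).
  move=> I [pr b]; have [_ Si2] := priced_common pr; split=> //; split=> //; rewrite ?setU0 //.
  - by move=> u y; rewrite inE.
  - by move=> y; rewrite inE negbK => yS _; apply: mem_span; rewrite !inE yS leqnn.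
move=> [[S1 p1] K1] c; rewrite cards0 add0n /=.
have totle I q T : priced I T q -> label_sum q <= nV * l.
  by move=> pr; rewrite /nV -sum_nat_const; apply: leq_sum => x _; apply: pr_le pr x.
have vle I q T : bounded m I -> priced I T q -> value T q <= m * l.
  move=> b pr; apply: leq_trans (value_le pr) _; rewrite leq_mul2r.
  by rewrite b ?orbT //; apply: priced_common pr.
have SV : 3 * #|~: S| <= 3 * nV by rewrite leq_mul2l (max_card (mem (~: S))).
have [Kk|kK] := ltnP #|K1| kap.
  apply: (@strat_ret _ _ _ _ S1) => I [[pr b] [/= pr1 dn h1 h2]]; split.
  - exact: priced_common pr1.
  - move=> T cT; have := @level_bound _ I T S1 K1 p1 l cT.
    case: (pr1) => [Si1 ple plt cheap p_up].
    have up j : j < l -> [set x | j < p1 x] \subset span I.1 (upper S1 p1 j).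
      move=> jl; apply/subsetP=> v; rewrite inE => vj.
      have [vS|vS] := boolP (v \in S1); first by apply: mem_span; rewrite inE vS ltnW.
      apply: mem_span_mono (p_up v vS _); last exact: leq_ltn_trans vj.
      by apply: upper_anti; rewrite -ltnS prednK // (leq_ltn_trans _ vj).
    have lo j : j < l -> [set x | p1 x <= j] \subset span I.2 (lower S1 p1 j :|: K1).
      move=> jl; apply/subsetP=> v; rewrite inE => vj.
      apply: mem_span_mono (dn v (leq_ltn_trans vj jl)); apply: setSU; exact: lower_mono.
    move=> /(_ up lo) /leq_trans; apply; rewrite leq_add2r leq_mul2l leq_add2l.
    by rewrite (ltnW Kk) orbT.
  have t1 := totle I p1 S1 pr1; have v1 := leq_mul (leqnn L) (vle I p1 S1 b pr1).
  rewrite /= in h2; have t2 := leq_mul (leqnn 2) t1.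
  by rewrite [(_ %/ kap).+1 * _]mulSn; plia.
have [gain|gain] := leqP (kap + value S p) (value S1 p1); last first.
  apply: (strat_void set0) => I [_ [_ _ h _]].
  by move: (leq_trans (leq_add kK (leqnn (value S p))) h); rewrite leqNgt gain.
have [vm|vm] := leqP (value S1 p1) (m * l); last first.
  apply: (strat_void set0) => I [[_ b] [/= pr1 _ _ _]].
  by have := vle I p1 S1 b pr1; rewrite leqNgt vm.
apply: strat_conseq (IHn S1 p1 _) _ _; first by nlia.
  by move=> I [[_ b] [pr1 _ _ _]].
move=> S2 d I [_ [_ _ _ h1]] [h2 h3 h4]; split=> //.
have dv : ((m * l - value S1 p1) %/ kap).+1 <= (m * l - value S p) %/ kap.
  have hk : kap <= m * l - value S p by nlia.
  rewrite -[in leqRHS](subnK hk) divnDr ?dvdnn // divnn k0 addn1 ltnS.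
  by apply: leq_div2r; nlia.
have dv' := leq_mul dv (leqnn (3 * nV)).
by rewrite [(_ %/ kap).+1 * _]mulSn; rewrite /= in h1; plia.
Qed.

Lemma auction m kap : m <= 2 ^ L -> 0 < kap ->
  strat (fun I => bounded m I)
    (fun S' c I => [/\ common I S',
      (forall T, common I T -> l * #|T| <= l * (#|S'| + kap) + #|S'|) &
      c <= 2 * (#|V| * l) + L * (m * l) + ((m * l) %/ kap).+1 * (3 * #|V|)]).
Proof.
move=> mL k0; apply: strat_conseq (auction_run set0 (fun=> 0) mL k0) _ _.
  move=> I b; split=> //; split=> //; first exact: indep_set0.
  - by move=> u; rewrite inE.
  - by move=> u; rewrite inE.
move=> S c I _ [h1 h2]; have -> : value set0 (fun=> 0) = 0 by rewrite /value big_set0.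
rewrite subn0 => h3; split=> //; apply: leq_trans h3.
by rewrite -addnA leq_addr.
Qed.

End Auction.

(** * The combined algorithm *)

Section Intersection.
Variable V : finType.
Implicit Types (S T : {set V}) (I : inst V).

(** Supplies the estimate of r. Maximality means that every element is spanned by [S] in M1 or in
    M2, and duality gives the factor two. *)
Lemma greedy : strat (fun _ : inst V => True)
  (fun S c I => [/\ common I S, bounded (2 * #|S|) I & c <= 2 * #|V|]).
Proof.
suff H s S : strat (fun I => common I S)
    (fun S' c I => [/\ common I S', S \subset S',
      (forall v, v \in s -> v \in span I.1 S' \/ v \in span I.2 S') & c <= 2 * size s]).
  apply: strat_conseq (H (enum V) set0) _ _; first by move=> I _; split; apply: indep_set0.
  move=> S c I _ [cS _ cover]; rewrite -cardE => le; split=> // T cT; rewrite mul2n -addnn.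
  apply: (card_common_le (A := span I.1 S) (B := ~: span I.1 S) cT); rewrite ?setUCr //.
  by apply/subsetP=> v; rewrite inE; case: (cover v) => [|->|//]; rewrite ?mem_enum.
elim: s S => [|v s IHs] S; first by apply: (@strat_ret _ _ _ _ S) => I cS; split.
have [vS|vS] := boolP (v \in S).
  apply: strat_conseq (IHs S) _ _ => // S' c I _ [h1 h2 h3 h4]; split=> //; last by apply: leq_trans h4 _; rewrite leq_mul2l leqnSn.
  move=> w; rewrite inE => /predU1P[->|/h3 //]; left; exact: mem_span (subsetP h2 v vS).
apply: (strat_span (o := Oracle1) (X := S) (v := v)) => //; first by move=> I [].
  apply: strat_conseq (IHs S) _ _; first by move=> I [].
  move=> S' c I [_ v1] [h1 h2 h3 h4]; split=> //; last by rewrite mulnS add2n ltnS; apply: leqW.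
  move=> w; rewrite inE => /predU1P[->|/h3 //]; left; exact: mem_span_mono v1.
apply: (strat_span (o := Oracle2) (X := S) (v := v)) => //; first by move=> I [[]].
  apply: strat_conseq (IHs S) _ _; first by move=> I [[]].
  move=> S' c I [_ v1] [h1 h2 h3 h4]; split=> //; last by rewrite mulnS add2n !ltnS.
  move=> w; rewrite inE => /predU1P[->|/h3 //]; right; exact: mem_span_mono v1.
apply: strat_conseq (IHs (v |: S)) _ _.
  by move=> I [[[Si1 Si2] v1] v2]; split; apply: indep_setU1.
move=> S' c I _ [h1 h2 h3 h4]; split=> //; last by rewrite mulnS add2n !ltnS.
  by apply: subset_trans h2; apply: subsetUr.
move=> w; rewrite inE => /predU1P[->|/h3 //].
by left; apply: mem_span; apply: (subsetP h2); apply: setU11.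
Qed.

Lemma root6 m : 0 < m -> exists2 q, 0 < q & q ^ 6 <= m < 64 * q ^ 6.
Proof.
move=> m0; have ex : exists q, q ^ 6 <= m by exists 1; rewrite exp1n.
have ub q : q ^ 6 <= m -> q <= m.
  by move=> h; apply: leq_trans h; case: q => // q; rewrite -[X in X <= _]expn1 leq_pexp2l.
case: (ex_maxnP ex ub) => q qm qmax.
have q0 : 0 < q by apply: qmax; rewrite exp1n.
(* 64 = 2 ^ 6: by maximality of [q], the sixth power of 2q exceeds [m]. *)
exists q => //; rewrite qm /= -[64]/(2 ^ 6) -expnMn ltnNge.
apply/negP => /qmax; nlia.
Qed.

(** * Numerical estimates for the chosen parameters *)

Section Costs.
Variables (n m q L : nat).
Hypotheses (q0 : 0 < q) (L0 : 0 < L) (mq : m < 64 * q ^ 6) (mn : m <= 2 * n) (n0 : 0 < n).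

Let leq_unit a b : 0 < b -> a <= a * b.
Proof. by move=> b0; rewrite leq_pmulr. Qed.

(** Label bound [q] and tolerance [q ^ 5] give at most 64 q^2 + 1 rounds, hence 195 = 65 * 3; the
    other two terms contribute 2 each. *)
Lemma auction_cost :
  2 * (n * q) + L * (m * q) + ((m * q) %/ q ^ 5).+1 * (3 * n) <= 199 * (n * q ^ 5 * L).
Proof.
have qq : q <= q ^ 5 by rewrite -{1}(expn1 q) leq_pexp2l.
have q2 : q ^ 2 <= q ^ 5 by rewrite leq_pexp2l.
have d : (m * q) %/ q ^ 5 <= 64 * q ^ 2.
  rewrite -ltnS ltn_divLR ?expn_gt0 ?q0 //.
  apply: leq_ltn_trans (_ : _ <= 64 * q ^ 2 * q ^ 5) _; last by rewrite ltn_pmul2r // expn_gt0 q0.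
  have -> : 64 * q ^ 2 * q ^ 5 = 64 * q ^ 6 * q by ring.
  by rewrite leq_mul2r ltnW ?orbT.
have a1 : n * q <= n * q ^ 5 * L by apply: leq_trans (leq_unit _ L0); rewrite leq_mul2l qq orbT.
have a2 : L * (m * q) <= 2 * (n * q ^ 5 * L).
  have -> : 2 * (n * q ^ 5 * L) = L * (2 * n * q ^ 5) by ring.
  by rewrite leq_mul2l (leq_mul mn qq) orbT.
have a3 : ((m * q) %/ q ^ 5).+1 * (3 * n) <= 195 * (n * q ^ 5 * L).
  apply: leq_trans (_ : 65 * q ^ 5 * (3 * n) <= _).
    by apply: leq_mul => //; have : 0 < q ^ 5 by [rewrite expn_gt0 q0]; move: d q2; clear; lia.
  have -> : 65 * q ^ 5 * (3 * n) = 195 * (n * q ^ 5) by ring.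
  by rewrite leq_mul2l leq_unit // orbT.
by move: a1 a2 a3; clear; set X := n * q ^ 5 * L; lia.
Qed.

(** 11 = 3 + 2 + 6, from L + 2 <= 3L, m + 1 <= 3n and L + 1 <= 2L. *)
Lemma layer_cost_le : n * L.+2 + (n + n) + m.+1 * L.+1 <= 11 * (n * L).
Proof.
have a1 : m.+1 * L.+1 <= 3 * n * (2 * L) by apply: leq_mul; nlia.
have a2 : n * L.+2 <= n * (3 * L) by rewrite leq_mul2l; nlia.
have a3 := leq_unit n L0.
have e1 : 3 * n * (2 * L) = 6 * (n * L) by ring.
have e2 : n * (3 * L) = 3 * (n * L) by ring.
by rewrite e1 e2 in a1 a2; move: a1 a2 a3; clear; lia.
Qed.

(** With h = q^2 and tau about n / q^2 the main terms balance at n q^4 L: list entries number about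
    q^6 tau, at most about q^4 saturated elements are listed for each light one, and there are about
    q^6 / h passes of cost nL. The successor in [tau] keeps it positive. 602 = 132 + 4 + 455 for
    these, plus 1 + 4 + 6 for the rest. *)
Lemma reach_cost_le :
  n + (L.+1 * (m * (n %/ q ^ 2).+1) + (2 + ((n * q ^ 2) %/ (n %/ q ^ 2).+1) * L.+1) * n +
  (m %/ q ^ 2).+1 * (2 * n + m * L.+1 + 1) + m * L.+1 + m.+1 * L.+1) <= 602 * (n * q ^ 4 * L).
Proof.
have p2 : 0 < q ^ 2 by rewrite expn_gt0 q0.
have p4 : 0 < q ^ 4 by rewrite expn_gt0 q0.
have L2 : L.+1 <= 2 * L by nlia.
have nL := leq_unit n L0.
have nq : n * L <= n * q ^ 4 * L by rewrite leq_mul2r (leq_unit n p4) orbT.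
have a1 : L.+1 * (m * (n %/ q ^ 2).+1) <= 132 * (n * q ^ 4 * L).
  have b : m * (n %/ q ^ 2).+1 <= 66 * (n * q ^ 4).
    have e : 64 * q ^ 6 * (n %/ q ^ 2) = 64 * q ^ 4 * (n %/ q ^ 2 * q ^ 2) by ring.
    have b1 : m * (n %/ q ^ 2) <= 64 * (n * q ^ 4).
      apply: leq_trans (leq_mul (ltnW mq) (leqnn _)) _; rewrite e.
      have -> : 64 * (n * q ^ 4) = 64 * q ^ 4 * n by ring.
      by rewrite leq_mul2l leq_trunc_div orbT.
    have b2 : n <= n * q ^ 4 := leq_unit n p4.
    by rewrite mulnS; move: b1 b2 mn; clear; lia.
  apply: leq_trans (leq_mul L2 b) _.
  by apply: eq_leq; ring.
have a2 : (2 + ((n * q ^ 2) %/ (n %/ q ^ 2).+1) * L.+1) * n <= 4 * (n * q ^ 4 * L).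
  have b : (n * q ^ 2) %/ (n %/ q ^ 2).+1 <= q ^ 4.
    rewrite -ltnS ltn_divLR // mulSn.
    have lt : n < (n %/ q ^ 2).+1 * q ^ 2 by rewrite ltn_ceil.
    have : n * q ^ 2 <= q ^ 4 * (n %/ q ^ 2).+1.
      have -> : q ^ 4 * (n %/ q ^ 2).+1 = (n %/ q ^ 2).+1 * q ^ 2 * q ^ 2 by ring.
      by rewrite leq_mul2r (ltnW lt) orbT.
    by move=> h; apply: leq_ltn_trans h _; rewrite addSn ltnS leq_addl.
  have b2 := leq_mul b L2.
  rewrite mulnDl; have -> : 4 * (n * q ^ 4 * L) = 2 * (n * q ^ 4 * L) + q ^ 4 * (2 * L) * n.
    by ring.
  by apply: leq_add; [rewrite leq_mul2l; apply: leq_trans nL nq|rewrite leq_mul2r b2 orbT].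
have c1 : m * L.+1 <= 4 * (n * L).
  by apply: leq_trans (leq_mul mn L2) _; apply: eq_leq; ring.
have c2 : m.+1 * L.+1 <= 6 * (n * L).
  by apply: leq_trans (_ : 3 * n * (2 * L) <= _); [apply: leq_mul; nlia|apply: eq_leq; ring].
have a3 : (m %/ q ^ 2).+1 * (2 * n + m * L.+1 + 1) <= 455 * (n * q ^ 4 * L).
  have b : (m %/ q ^ 2).+1 <= 65 * q ^ 4.
    have : m %/ q ^ 2 <= 64 * q ^ 4.
      rewrite -ltnS ltn_divLR //; apply: leq_trans mq _.
      have -> : 64 * q ^ 6 = 64 * q ^ 4 * q ^ 2 by ring.
      by rewrite leq_mul2r leqnSn orbT.
    by nlia.
  apply: leq_trans (leq_mul b (_ : _ <= 7 * (n * L))) _; first by move: c1 nL n0; clear; lia.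
  by apply: eq_leq; ring.
by move: a1 a2 a3 c1 c2 nL nq; clear; set X := n * q ^ 4 * L; lia.
Qed.

End Costs.

Definition max_inst I S := max_common_indep I.1 I.2 S.

(** The cost is stated through the size of the output, which dominates |S0|. The first stages take
    at most 928 and the last 65 * 602 = 39130 times |V| q^5 L; the factored constant 41 * 1000
    avoids a large unary numeral. *)
Lemma intersect : strat (fun _ : inst V => True)
  (fun S c I => max_inst I S /\ (0 < #|S| -> exists q L, [/\ q ^ 6 <= 2 * #|S|,
      L <= up_log 2 (2 * #|S|) & c <= 41 * (1000 * (#|V| * q ^ 5 * L))])).
Proof.
have toI I T : T \in common_indep I.1 I.2 -> common I T by rewrite inE => /andP[].
have ofI I T : common I T -> T \in common_indep I.1 I.2 by rewrite inE => -[-> ->].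
apply: strat_bind greedy _ => S0 c0.
pose m := 2 * #|S0|.
have [s0|s0] := posnP #|S0|.
  apply: (@strat_ret _ _ _ _ S0) => I [_ [cS b _]]; split; last by rewrite s0.
  by split; [apply: ofI | move=> T /toI/b; rewrite s0].
have m0 : 0 < m by rewrite muln_gt0.
have [q q0 /andP[qm mq]] := root6 m0.
pose L := up_log 2 m; have mL : m <= 2 ^ L by apply: up_logP.
have L0 : 0 < L by rewrite /L up_log_gt0 /= /m; nlia.
have sn : #|S0| <= #|V| := max_card _.
have mn : m <= 2 * #|V| by rewrite leq_mul2l sn orbT.
have n0 : 0 < #|V| := leq_trans s0 sn.
have q5 : 0 < q ^ 5 by rewrite expn_gt0 q0.
apply: (@strat_conseq _ _ (fun I => bounded m I /\ (common I S0 /\ c0 <= 2 * #|V|)));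
    [|by move=> I [_ [cS b le]]|by move=> S c I _; exact: id].
- apply: strat_bind.
    by apply: strat_conseq (auction V q mL q5) _ (fun r c I _ H => H) => I [].


  move=> S1 c1; apply: strat_bind.
    by apply: strat_conseq (layers S1 (q ^ 5) mL) _ (fun r c I _ H => H) => I [[b _] [cS1 _ _]].
  move=> S2 c2; apply: strat_bind.
    apply: strat_conseq (finish S2 mL (h := q ^ 2) (tau := (#|V| %/ q ^ 2).+1) _ _) _ (fun r c I _ H => H) => //.
      by rewrite expn_gt0 q0.
    by move=> I [[[b _] _] [cS2 _ _ _]].
  move=> S3 c3; apply: (@strat_ret _ _ _ _ S3).
  move=> I [[[[b [cS0 le0]] [cS1 app1 le1]] [cS2 app2 s12 le2]] [cS3 opt s23 le3]].
  split; first by split; [apply: ofI|move=> T /toI/opt].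
  move=> _; exists q, L; have le03 := opt S0 cS0.
  have m3 : m <= 2 * #|S3| by rewrite leq_mul2l le03.
  split; [exact: leq_trans qm m3 | exact: leq_up_log |].
  (* Of the factor 65, 1 is the tolerance of the auction and 64 comes from |S1| / q with |S1| < 64
     q^6. *)
  have d1 : #|S2| - #|S1| <= 65 * q ^ 5.
    have h := app1 S2 cS2; have h1 := b S1 cS1.
    rewrite leq_subLR -(leq_pmul2l q0); apply: leq_trans h _.
    have : #|S1| <= q * (64 * q ^ 5) by rewrite mulnCA -expnS; apply: leq_trans h1 (ltnW mq).
    by rewrite !mulnDr; nlia.
  have d2 : #|S3| - #|S2| <= 64 * q.
    have h := app2 S3 cS3; have h1 := b S2 cS2.
    rewrite leq_subLR -(leq_pmul2l q5); apply: leq_trans h _.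
    by rewrite mulnDr leq_add2l mulnCA -expnSr; apply: leq_trans h1 (ltnW mq).
  have k1 := leq_trans le1 (auction_cost q0 L0 mq mn).
  set X := #|V| * q ^ 5 * L in k1 *.
  have nX : #|V| <= X.
    by apply: leq_trans (leq_pmulr _ L0); apply: leq_pmulr.
  have k2 : c2 <= 727 * X.
    apply: leq_trans le2 _.
    have h : #|V| * q ^ 5 <= X := leq_pmulr _ L0.
    have h2 : (q ^ 5 + (#|S2| - #|S1|)) * layer_cost V L m <= 66 * q ^ 5 * (11 * (#|V| * L)).
      by apply: leq_mul; [nlia | exact: (layer_cost_le q0 L0 mq mn n0)].
    have e : 66 * q ^ 5 * (11 * (#|V| * L)) = 726 * X by rewrite /X; ring.
    by rewrite e in h2; move: h h2; clear; lia.
  have k3 : c3 <= 40 * (1000 * X).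
    apply: leq_trans le3 _.
    have h2 : (#|S3| - #|S2|).+1 * reach_cost V m L (q ^ 2) (#|V| %/ q ^ 2).+1 <=
        65 * q * (602 * (#|V| * q ^ 4 * L)).
      by apply: leq_mul; [nlia | exact: (reach_cost_le q0 L0 mq mn n0)].
    have e : 65 * q * (602 * (#|V| * q ^ 4 * L)) = 65 * (602 * X) by rewrite /X; ring.
    by rewrite e in h2; apply: leq_trans h2 _; clear; lia.
  by move: le0 k1 k2 k3 nX; clear; lia.
Qed.

End Intersection.

(** * Real-valued bounds and the theorem *)

Import Order.TTheory GRing.Theory Num.Theory.
Local Open Scope ring_scope.

(** 6 = 2 * 3: q^5 <= (2r)^(5/6) <= 2 r^(5/6), and rounding the logarithm up gives L ln 2 <= ln (2r)
    + ln 2 <= 3 ln r, where r >= 2 is used. *)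
Lemma query_bound_le (R : realType) (n r q L : nat) : (2 <= r)%N ->
  (q ^ 6 <= 2 * r)%N -> (L <= up_log 2 (2 * r))%N ->
  (41 * (1000 * (n * q ^ 5 * L)))%:R <=
    6 * (41 * 1000) / ln 2 * (n%:R * r%:R `^ (5 / 6) * ln r%:R) :> R.
Proof.
move=> r2 qr Lr.
have r0 : 0 < r%:R :> R by rewrite ltr0n (ltn_trans _ r2).
have ln2 : 0 < ln 2 :> R by rewrite ln_gt0 // ltr1n.
have lnr : ln 2 <= ln r%:R :> R by rewrite ler_ln ?posrE // ler_nat.
have q5 : (q ^ 5)%:R <= 2 * r%:R `^ (5 / 6) :> R.
  have e : (q ^ 5)%:R = ((q ^ 6)%:R : R) `^ (5 / 6).
    rewrite !natrX -!powR_mulrn // -powRrM; by congr (_ `^ _); lra.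
  rewrite e; apply: (@le_trans _ _ ((2 * r%:R) `^ (5 / 6))).
    apply: ge0_ler_powR; rewrite ?nnegrE ?divr_ge0 ?mulr_ge0 ?ler0n //.
    by rewrite -natrM ler_nat.
  rewrite powRM ?ler0n // ler_wpM2r ?powR_ge0 //.
  rewrite -[leRHS]powRr1 // ler_powR ?ler1n //; lra.
have L5 : L%:R * ln 2 <= 3 * ln r%:R :> R.
  have : (L%:R - 1) * ln 2 <= ln (2 * r%:R) :> R.
    case: L Lr => [|l] lr.
      rewrite sub0r mulN1r; apply: (@le_trans _ _ 0); first by rewrite oppr_le0 ltW.
      by rewrite ln_ge0 // -natrM ler1n muln_gt0 (ltn_trans _ r2).
    rewrite -natr1 addrK mulr_natl -lnXn //.
    rewrite ler_ln ?posrE ?exprn_gt0 ?mulr_gt0 ?ltr0n ?(ltn_trans _ r2) //.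
    rewrite -natrM -natrX ler_nat.
    apply: leq_trans (_ : 2 ^ (up_log 2 (2 * r)).-1 <= _)%N.
      by rewrite leq_exp2l // -ltnS prednK ?(leq_ltn_trans _ lr).
    by apply/ltnW/up_log_gtn => //; rewrite (@leq_pmulr 2) // (ltn_trans _ r2).
  rewrite lnM ?posrE //; lra.
have -> : 6 * (41 * 1000) / ln 2 * (n%:R * r%:R `^ (5 / 6) * ln r%:R) =
    41 * (1000 * (n%:R * (2 * r%:R `^ (5 / 6)) * (3 * ln r%:R / ln 2))) :> R.
  field; exact: lt0r_neq0.
move: (q ^ 5)%N q5 => Q q5.
rewrite !natrM !ler_pM2l //.
apply: ler_pM; rewrite ?mulr_ge0 ?ler0n //; first by rewrite ler_wpM2l.
by rewrite ler_pdivlMr.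
Qed.

Theorem theorem4p7 (R : realType) :
  exists alg : forall V : finType, query_alg V,
  [/\ (forall (V : finType) (M1 M2 : matroid V),
         max_common_indep M1 M2 (run M1 M2 (alg V))),
      (exists C : R, forall (V : finType) (M1 M2 : matroid V),
         (2 <= intersection_rank M1 M2)%N ->
         let n : R := #|V|%:R in
         let r : R := (intersection_rank M1 M2)%:R in
         (num_queries M1 M2 (alg V))%:R <=
           C * (n * r `^ (5 / 6) * ln r
                + n `^ (6 / 5) * r `^ (3 / 5) * ln r `^ (4 / 5)))
    & (forall c : R, 0 < c ->
       exists (C : R) (k N : nat), forall (V : finType) (M1 M2 : matroid V),
         (N <= #|V|)%N ->
         let n : R := #|V|%:R in
         let r : R := (intersection_rank M1 M2)%:R in
         c * n <= r ->
         (num_queries M1 M2 (alg V))%:R <= C * n `^ (11 / 6) * ln n ^+ k)].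
Proof.
have main (V : finType) : exists a : query_alg V, forall M1 M2 : matroid V,
    max_common_indep M1 M2 (run M1 M2 a) /\
    (0 < #|run M1 M2 a| -> exists q L, [/\ q ^ 6 <= 2 * #|run M1 M2 a|,
      L <= up_log 2 (2 * #|run M1 M2 a|) &
      num_queries M1 M2 a <= 41 * (1000 * (#|V| * q ^ 5 * L))])%N.
  have [a Ha] := intersect V; exists (to_alg a) => M1 M2.
  by rewrite run_to_alg num_queries_to_alg; apply: (Ha (M1, M2)).
(* The strategies exist only as propositions, so the algorithm for each ground set is extracted by
   choice. *)
pose alg V := projT1 (cid (main V)).
have algP V M1 M2 := projT2 (cid (main V)) M1 M2.
have rankE (V : finType) (M1 M2 : matroid V) :
    intersection_rank M1 M2 = #|run M1 M2 (alg V)|.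
  have [[mem_run max_run] _] := algP V M1 M2.
  apply/eqP; rewrite eqn_leq; apply/andP; split.
    by apply/bigmax_leqP => T /max_run.
  exact: (leq_bigmax_cond (F := fun T : {set V} => #|T|)).
pose C0 : R := 6 * (41 * 1000) / ln 2.
have C0_ge0 : 0 <= C0 by apply: divr_ge0; rewrite ?ln_ge0 ?ler1n ?mulr_ge0 ?ler0n.
have bound (V : finType) (M1 M2 : matroid V) : (2 <= intersection_rank M1 M2)%N ->
    (num_queries M1 M2 (alg V))%:R <= C0 * (#|V|%:R *
      (intersection_rank M1 M2)%:R `^ (5 / 6) * ln (intersection_rank M1 M2)%:R).
  rewrite rankE => r2; have [_ []] := algP V M1 M2; first exact: ltn_trans r2.
  move=> q [L [q6 Lr le]]; apply: le_trans (query_bound_le R #|V| r2 q6 Lr).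
  by rewrite ler_nat.
exists alg; split.
- by move=> V M1 M2; have [] := algP V M1 M2.
- exists C0; move=> V M1 M2 r2; cbv zeta; apply: le_trans (bound V M1 M2 r2) _.
  rewrite ler_wpM2l // lerDl mulr_ge0 ?powR_ge0 //.
  by rewrite mulr_ge0 ?powR_ge0.
(* This threshold forces c n >= 2, hence r >= 2, so that the general bound applies. *)
move=> c c0; exists C0, 1%N, (Num.truncn (2 / c)).+1; move=> V M1 M2 nN n r cr.
have n1 : 2 / c < n.
  by apply: lt_le_trans (truncnS_gt _) _; rewrite ler_nat.
have r2 : 2 <= r by apply: le_trans cr; rewrite mulrC -ler_pdivrMr // ltW.
rewrite ler_nat in r2; apply: le_trans (bound V M1 M2 r2) _.
have rn : r <= n by rewrite ler_nat rankE max_card.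
have r0 : 0 < r by rewrite ltr0n (ltn_trans _ r2).
have n0 : 0 < n by apply: lt_le_trans rn.
rewrite expr1 -[leRHS]mulrA ler_wpM2l //.
have -> : n `^ (11 / 6) = n * n `^ (5 / 6).
  have -> : 11 / 6 = 1 + 5 / 6 :> R by lra.
  by rewrite powRD ?(gt_eqF n0) ?implybT // powRr1 // ltW.
apply: ler_pM; rewrite ?mulr_ge0 ?powR_ge0 ?(ltW r0) ?(ltW n0) //.
- by rewrite ln_ge0 // ler1n (ltn_trans _ r2).
- rewrite (ler_wpM2l (ltW n0)) //; apply: ge0_ler_powR; rewrite ?nnegrE ?(ltW r0) ?(ltW n0) //.
  by rewrite divr_ge0.
by rewrite ler_ln ?posrE.
Qed.
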